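(* Let $g_1,\ldots,g_p\colon\mathbb{C}^n\to\mathbb{C}$ be polynomial functions such that $S:=\{x\in\mathbb{C}^n : g_1(x)=0,\ldots,g_p(x)=0\}$ is a reduced smooth complete intersection variety, i.e., the vectors $\nabla g_1(x),\ldots,\nabla g_p(x)$ are $\mathbb{C}$-linearly independent for all $x\in S$. Let $f\colon\mathbb{C}^n\to\mathbb{C}$ be a polynomial function such that the restriction $f|_S$ of $f$ on $S$ is Newton non-degenerate at infinity. Then $$T_\infty(f|_S)\subset\Sigma_\infty(f|_S)\cup K_0(f|_S)\cup\{0\}.$$ Moreover, if the polynomial $f$ is convenient, then $T_\infty(f|_S)=\emptyset$.
   Context: The gradient of a polynomial $f$ on $\mathbb{C}^n$ is $\nabla f(x):=\left(\overline{\frac{\partial f}{\partial x_1}(x)},\ldots,\overline{\frac{\partial f}{\partial x_n}(x)}\right)$. $\|\cdot\|$ is the standard Hermitian norm. $\mathbb{C}^*:=\mathbb{C}\setminus\{0\}$ and $\mathbb{C}^{*n}:=(\mathbb{C}^* )^n$. For nonempty $I\subset\{1,\ldots,n\}$: $\mathbb{C}^I:=\{x\in\mathbb{C}^n : x_i=0 \text{ for all } i\notin I\}$ and $\mathbb{C}^{*I}:=\{x\in\mathbb{C}^I : x_i\neq0 \text{ for all } i\in I\}$. Newton polyhedra: for $f=\sum_\alpha a_\alpha x^\alpha$, the support $\mathrm{supp}(f)$ is the set of $\alpha\in\mathbb{Z}_+^n$ with $a_\alpha\neq0$, and the Newton polyhedron (at infinity) $\Gamma(f)$ is the convex hull of $\mathrm{supp}(f)$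 in $\mathbb{R}^n$ (the origin is not added). $f$ is convenient if $\Gamma(f)$ intersects each coordinate axis in a point different from the origin. For a closed face $\Delta$ of $\Gamma(f)$, $f_\Delta:=\sum_{\alpha\in\Delta}a_\alpha x^\alpha$ (and $f_\Delta:=0$ if $\Delta\cap\mathrm{supp}(f)=\emptyset$). For nonzero $q\in\mathbb{R}^n$, $d(q,\Gamma(f)):=\min\{\langle q,\alpha\rangle : \alpha\in\Gamma(f)\}$ and $\Delta(q,\Gamma(f)):=\{\alpha\in\Gamma(f) : \langle q,\alpha\rangle=d(q,\Gamma(f))\}$. The restriction $f|_{\mathbb{C}^I}$ is the polynomial consisting of the monomials of $f$ involving only the variables $x_i$, $i\in I$; when not identically zero, $\Gamma(f|_{\mathbb{C}^I})=\Gamma(f)\cap\mathbb{R}^I$, where $\mathbb{R}^I:=\{x\in\mathbb{R}^n : x_i=0 \text{ for all } i\notin I\}$. Non-degeneracy: $f|_S$ is Newton non-degenerate at infinity if for every nonempty $I\subset\{1,\ldots,n\}$ with $f|_{\mathbb{C}^I}\not\equiv0$, every (possibly empty) $J\subset\{j\in\{1,\ldots,p\} : g_j|_{\mathbb{C}^I}\not\equiv0\}$, and every $q\in\mathbb{R}^n$ with $\min_{i\in I}q_i<0$, writing $\Delta_0:=\Delta(q,\Gamma(f|_{\mathbb{C}^I}))$ and $\Delta_j:=\Delta(q,\Gamma(g_j|_{\mathbb{C}^I}))$ for $j\in J$: (i) the set $\{x\in\mathbb{C}^{*n} : g_{j,\Delta_j}(x)=0 \text{ for } j\in J\}$ is a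 reduced smooth complete intersection variety in $\mathbb{C}^{*n}$, i.e., the vectors $\nabla g_{j,\Delta_j}(x)$, $j\in J$, are $\mathbb{C}$-linearly independent at every point of this set; (ii) if $d(q,\Gamma(f|_{\mathbb{C}^I}))<0$, then the set $\{x\in\mathbb{C}^{*n} : f_{\Delta_0}(x)=0 \text{ and } g_{j,\Delta_j}(x)=0 \text{ for } j\in J\}$ is a reduced smooth complete intersection variety in $\mathbb{C}^{*n}$, i.e., the vectors $\nabla f_{\Delta_0}(x)$ and $\nabla g_{j,\Delta_j}(x)$, $j\in J$, are $\mathbb{C}$-linearly independent at every point of this set. $\Sigma_\infty(f|_S)$ is the set of all $c\in\mathbb{C}$ for which there exist a nonempty $I\subset\{1,\ldots,n\}$ with $f|_{\mathbb{C}^I}\not\equiv0$, a (possibly empty) $J\subset\{j\in\{1,\ldots,p\} : g_j|_{\mathbb{C}^I}\not\equiv0\}$, a vector $q\in\mathbb{R}^n$ with $\min_{i\in I}q_i<0$ and $d(q,\Gamma(f|_{\mathbb{C}^I}))=0$, a point $x\in\mathbb{C}^{*I}$, and scalars $\lambda_j\in\mathbb{C}$, $j\in J$, such that $c=f_{\Delta_0}(x)$, $g_{j,\Delta_j}(x)=0$ for $j\in J$, and $\nabla f_{\Delta_0}(x)+\sum_{j\in J}\lambda_j\nabla g_{j,\Delta_j}(x)=0$, where $\Delta_0:=\Delta(q,\Gamma(f|_{\mathbb{C}^I}))$ and $\Delta_j:=\Delta(q,\Gamma(g_j|_{\mathbb{C}^I}))$. $K_0(f|_S)$ is the set of all $c\in\mathbb{C}$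 for which there exist $x\in S$ and $\lambda_1,\ldots,\lambda_p\in\mathbb{C}$ with $f(x)=c$ and $\nabla f(x)+\sum_{j=1}^p\lambda_j\nabla g_j(x)=0$. $T_\infty(f|_S)$ (tangency values at infinity) is the set of all $c\in\mathbb{C}$ for which there exist sequences $\{x^k\}_{k\in\mathbb{N}}\subset S$ and $\{\lambda_j^k\}_{k\in\mathbb{N}}\subset\mathbb{C}$, $j=1,\ldots,p+1$, such that $\|x^k\|\to\infty$, $f(x^k)\to c$, and $\nabla f(x^k)+\sum_{j=1}^p\lambda_j^k\nabla g_j(x^k)=\lambda_{p+1}^k x^k$ for all $k\in\mathbb{N}$. *)

(* Defs.v *)
From HB Require Import structures.
From mathcomp Require Import all_boot all_order all_algebra complex.
From mathcomp Require Import mpoly.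
From mathcomp Require Import boolp classical_sets reals constructive_ereal.
From mathcomp Require Import interval_inference.
From mathcomp Require Import topology normedtype sequences convex.
Set Implicit Arguments.
Unset Strict Implicit.
Unset Printing Implicit Defensive.
Import Order.TTheory GRing.Theory Num.Theory numFieldNormedType.Exports.
Local Open Scope ring_scope.
Local Open Scope classical_set_scope.

Definition hermitian_norm (R : realType) (n : nat) (x : 'rV[R[i]]_n) : R :=
  Num.sqrt (\sum_(i < n) ComplexField.Normc.normc (x 0 i) ^+ 2).

(* The conjugates make [\sum_i v_i * (nabla h x)_i^*] the differential of [h]. *)
Definition nabla (R : realType) (n : nat) (h : {mpoly R[i][n]})
    (x : 'rV[R[i]]_n) : 'rV[R[i]]_n :=
  \row_(i < n) (h^`M(i)).@[x 0]^*.

Definition zero_locus (R : realType) (n : nat) (hs : seq {mpoly R[i][n]}) :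
    set 'rV[R[i]]_n :=
  [set x | forall h, h \in hs -> h.@[x 0] = 0].

(* [hs] is a sequence, not a set: [free] sees repetitions, so two equal
   equations are (as they should be) never independent. *)
Definition smooth_complete_intersection (R : realType) (n : nat)
    (U : set 'rV[R[i]]_n) (hs : seq {mpoly R[i][n]}) : Prop :=
  forall x, (U `&` zero_locus hs) x -> free [seq nabla h x | h <- hs].

(* The two tori (C^* )^n and (C^* )^I. *)
Definition torus (R : realType) (n : nat) : set 'rV[R[i]]_n :=
  [set x | forall i, x 0 i != 0].

Definition coord_torus (R : realType) (n : nat) (I : {set 'I_n}) :
    set 'rV[R[i]]_n :=
  [set x | forall i, (x 0 i != 0) = (i \in I)].

(* [f] restricted to C^I, still seen as a polynomial in [n] variables. *)
Definition mrestrict (R : realType) (n : nat) (I : {set 'I_n})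
    (f : {mpoly R[i][n]}) : {mpoly R[i][n]} :=
  \sum_(m <- msupp f | [forall i, (i \notin I) ==> (m i == 0%N)])
    f@_m *: 'X_[m].

Definition convex_hull (R : realType) (n : nat) (A : set 'rV[R]_n) :
    set 'rV[R]_n :=
  smallest (@convex_set R 'rV[R]_n) A.

Definition exponent (R : realType) (n : nat) (m : 'X_{1..n}) : 'rV[R]_n :=
  \row_(i < n) (m i)%:R.

Definition newton_polyhedron (R : realType) (n : nat) (f : {mpoly R[i][n]}) :
    set 'rV[R]_n :=
  convex_hull [set exponent R m | m in [set m | m \in msupp f]].

Definition convenient (R : realType) (n : nat) (f : {mpoly R[i][n]}) : Prop :=
  forall i : 'I_n, exists a : 'rV[R]_n,
    [/\ newton_polyhedron f a, a != 0 & forall j, j != i -> a 0 j = 0].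

Definition dotr (R : realType) (n : nat) (q a : 'rV[R]_n) : R :=
  \sum_(i < n) q 0 i * a 0 i.

(* On the polytopes where it is used the infimum is a minimum, see
   [newton_dist_min]. *)
Definition newton_dist (R : realType) (n : nat) (q : 'rV[R]_n)
    (P : set 'rV[R]_n) : R :=
  inf [set dotr q a | a in P].

Definition newton_face (R : realType) (n : nat) (q : 'rV[R]_n)
    (P : set 'rV[R]_n) : set 'rV[R]_n :=
  [set a | P a /\ dotr q a = newton_dist q P].

Lemma dotr_half_space_convex (R : realType) (n : nat) (q : 'rV[R]_n) (d : R) :
  convex_set ([set a | d <= dotr q a] : set (convex_lmodType 'rV[R]_n)).
Proof.
move=> a b t; rewrite !inE /= => da db.
have -> : dotr q (t%:num *: a + (1 - t%:num) *: b) =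
    t%:num * dotr q a + (1 - t%:num) * dotr q b.
  rewrite /dotr !mulr_sumr -big_split; apply: eq_bigr => i _ /=.
  by rewrite !mxE mulrDr !(mulrCA (q 0 i)).
have -> : d = t%:num * d + (1 - t%:num) * d by rewrite -mulrDl addrC subrK mul1r.
by apply: lerD; apply: ler_wpM2l => //; rewrite onem_ge0.
Qed.

Lemma newton_dist_min (R : realType) (n : nat) (q : 'rV[R]_n)
    (f : {mpoly R[i][n]}) : f != 0 ->
  (exists a, newton_face q (newton_polyhedron f) a) /\
  forall a, newton_polyhedron f a ->
    newton_dist q (newton_polyhedron f) <= dotr q a.
Proof.
rewrite -msupp_eq0; case E: (msupp f) => [//|m0 s] _.
pose F (m : seq_sub (msupp f)) := dotr q (exponent R (val m)).
have m0P : m0 \in msupp f by rewrite E mem_head.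
have [m _ mP] := @arg_minP _ _ _ (SeqSub m0P) predT F isT.
have Gm : newton_polyhedron f (exponent R (val m)).
  by apply: sub_gen_smallest; exists (val m) => //=; exact: valP m.
have lb a : newton_polyhedron f a -> F m <= dotr q a.
  move=> /(_ [set b | F m <= dotr q b]); apply; split; first exact: dotr_half_space_convex.
  by move=> _ [m1 m1P <-]; have := mP (SeqSub m1P) isT.
have dE : newton_dist q (newton_polyhedron f) = F m.
  apply/eqP; rewrite eq_le; apply/andP; split.
    apply: ge_inf; last by exists (exponent R (val m)).
    by exists (F m) => _ [a /lb ? <-].
  apply: lb_le_inf; first by exists (F m), (exponent R (val m)).
  by move=> _ [a /lb ? <-].
by split; [exists (exponent R (val m)); split | rewrite dE].
Qed.

Definition face_part (R : realType) (n : nat) (f : {mpoly R[i][n]})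
    (D : set 'rV[R]_n) : {mpoly R[i][n]} :=
  \sum_(m <- msupp f | exponent R m \in D) f@_m *: 'X_[m].

(* f_{Delta(q, Gamma(f|C^I))} *)
Definition leading_part (R : realType) (n : nat) (I : {set 'I_n})
    (q : 'rV[R]_n) (f : {mpoly R[i][n]}) : {mpoly R[i][n]} :=
  face_part f (newton_face q (newton_polyhedron (mrestrict I f))).

(* min_(i in I) q_i, for nonempty [I]; [+oo] is only the neutral element. *)
Definition min_coord (R : realType) (n : nat) (I : {set 'I_n})
    (q : 'rV[R]_n) : \bar R :=
  \big[Order.min/+oo%E]_(i in I) (q 0 i)%:E.

Definition newton_nondegenerate_at_infinity (R : realType) (n p : nat)
    (f : {mpoly R[i][n]}) (g : 'I_p -> {mpoly R[i][n]}) : Prop :=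
  forall (I : {set 'I_n}) (J : {set 'I_p}) (q : 'rV[R]_n),
    I != finset.set0 -> mrestrict I f != 0 ->
    (forall j, j \in J -> mrestrict I (g j) != 0) ->
    (min_coord I q < 0)%E ->
    let gJ := [seq leading_part I q (g j) | j <- enum J] in
    smooth_complete_intersection (@torus R n) gJ /\
    (newton_dist q (newton_polyhedron (mrestrict I f)) < 0 ->
     smooth_complete_intersection (@torus R n) (leading_part I q f :: gJ)).

Definition Sigma_infty (R : realType) (n p : nat)
    (f : {mpoly R[i][n]}) (g : 'I_p -> {mpoly R[i][n]}) : set R[i] :=
  [set c | exists (I : {set 'I_n}) (J : {set 'I_p}) (q : 'rV[R]_n)
      (x : 'rV[R[i]]_n) (lambda : 'I_p -> R[i]),
    [/\ [/\ I != finset.set0, mrestrict I f != 0 &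
            forall j, j \in J -> mrestrict I (g j) != 0],
        (min_coord I q < 0)%E /\
        newton_dist q (newton_polyhedron (mrestrict I f)) = 0,
        coord_torus I x,
        c = (leading_part I q f).@[x 0] /\
        (forall j, j \in J -> (leading_part I q (g j)).@[x 0] = 0) &
        nabla (leading_part I q f) x +
        \sum_(j in J) lambda j *: nabla (leading_part I q (g j)) x = 0]].

Definition K_0 (R : realType) (n p : nat)
    (f : {mpoly R[i][n]}) (g : 'I_p -> {mpoly R[i][n]}) : set R[i] :=
  [set c | exists (x : 'rV[R[i]]_n) (lambda : 'I_p -> R[i]),
    [/\ zero_locus (codom g) x, f.@[x 0] = c &
        nabla f x + \sum_(j < p) lambda j *: nabla (g j) x = 0]].

(* [mu k] is the last multiplier, the coefficient of [x k]. Convergence to [c]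
   is for the norm topology, which the library attaches to [R[i]^o]. *)
Definition T_infty (R : realType) (n p : nat)
    (f : {mpoly R[i][n]}) (g : 'I_p -> {mpoly R[i][n]}) : set R[i] :=
  [set c | exists (x : nat -> 'rV[R[i]]_n) (lambda : nat -> 'I_p -> R[i])
      (mu : nat -> R[i]),
    [/\ forall k, zero_locus (codom g) (x k),
        hermitian_norm (x k) @[k --> \oo] --> +oo%R,
        (f.@[x k 0] : R[i]^o) @[k --> \oo] --> (c : R[i]^o) &
        forall k, nabla f (x k) + \sum_(j < p) lambda k j *: nabla (g j) (x k)
                  = mu k *: x k]].

(* Main.v *)
(** No curve selection is needed. Along an ultrafilter, write each coordinate of
    [x^k] and each conjugate multiplier as [exp T * y], where [y] converges and
    the log-modulus [T] has been shifted so that, for a single real vector [V],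
    the difference of any two of finitely many linear forms in [T] tends to [0]
    or to [-oo] according to the values of these forms at [V]. So [q = - V] and
    the limits of the [y]'s play the part of the exponents and of the leading
    coefficients of an analytic curve.

    With [kappa_j], [nu] the conjugate multipliers, dividing
    [x_i d_i f + sum_j kappa_j x_i d_i g_j = nu |x_i|^2] by its dominant term
    gives, in the limit, [L_i = nu0 |x0_i|^2] if [V_i] is a certain [v > 0] and
    [L_i = 0] otherwise, where [L_i] is [x_i] times a nontrivial combination of
    the [i]-th partial derivatives of the leading parts. If all [L_i] vanish,
    these gradients are dependent at [x0], and non-degeneracy leaves only
    [d(q) >= 0]. Otherwise [sum_i V_i L_i <> 0], and by Euler's identity this
    sum is [- d(q)] times the leading part of [f] at [x0], which is [0] when
    [d(q) < 0] since [f(x^k)] is bounded; so [d(q) > 0]. Finally, [d(q) > 0]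
    gives [c = 0], [d(q) = 0] gives [c] in [Sigma_infty], and [d(q) < 0] when
    [f] is convenient. *)

Require Import Defs.
From HB Require Import structures.
From mathcomp Require Import all_boot all_order all_algebra complex.
From mathcomp Require Import mpoly.
From mathcomp Require Import boolp classical_sets reals.
From mathcomp Require Import constructive_ereal topology normedtype sequences.
From mathcomp Require Import convex exp.
From mathcomp Require Import ring lra.
Set Implicit Arguments.
Unset Strict Implicit.
Unset Printing Implicit Defensive.
Import Order.TTheory GRing.Theory Num.Theory numFieldNormedType.Exports.
Local Open Scope ring_scope.
Local Open Scope classical_set_scope.

(** * Finite sums, products and conjunctions along a filter *)

Section BigLimits.
Variables (K : numFieldType) (T I : Type) (F : set_system T).
Context {FF : Filter F}.

Lemma cvg_sumr (r : seq I) (P : pred I) (f : I -> T -> K) (a : I -> K) :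
  (forall i, P i -> f i x @[x --> F] --> a i) ->
  \sum_(i <- r | P i) f i x @[x --> F] --> \sum_(i <- r | P i) a i.
Proof. by apply: cvg_big => x; exact: add_continuous. Qed.

Lemma cvg_prodr (r : seq I) (P : pred I) (f : I -> T -> K) (a : I -> K) :
  (forall i, P i -> f i x @[x --> F] --> a i) ->
  \prod_(i <- r | P i) f i x @[x --> F] --> \prod_(i <- r | P i) a i.
Proof. by apply: cvg_big => x; exact: mul_continuous. Qed.

Lemma cvg_exprn (f : T -> K) (a : K) n :
  f x @[x --> F] --> a -> f x ^+ n @[x --> F] --> a ^+ n.
Proof.
move=> fa; elim: n => [|n IH]; first by under eq_fun do rewrite expr0; exact: cvg_cst.
by under eq_fun do rewrite exprS; rewrite exprS; exact: cvgM.
Qed.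

End BigLimits.

Lemma near_all_mem (T : Type) (F : set_system T) {FF : Filter F} (I : eqType)
    (s : seq I) (P : I -> T -> Prop) :
  (forall i, i \in s -> \forall k \near F, P i k) ->
  \forall k \near F, forall i, i \in s -> P i k.
Proof.
elim: s => [|i s IH] H; first exact: filterE.
have Hi := H i (mem_head _ _).
have {}IH : \forall k \near F, forall j, j \in s -> P j k.
  by apply: IH => j js; apply: H; rewrite in_cons js orbT.
by apply: filterS2 Hi IH => k Hi IH j; rewrite in_cons => /predU1P[->//|/IH].
Qed.

(** * Real sequences along an ultrafilter *)

Section Ultralimits.
Variables (R : realType) (F : set_system nat).
Context {FU : UltraFilter F}.

(** Compactness gives a cluster point, and a cluster point of an ultrafilter is its limit. This
    replaces the extraction of subsequences. *)
Lemma ultra_bounded_cvg (r : nat -> R) (a b : R) :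
  (\forall k \near F, a <= r k <= b) -> exists l : R, r k @[k --> F] --> l.
Proof.
move=> rab.
have [|l [_ cl]] := @segment_compact R a b (r @ F) _.
  by apply: filterS rab => k; rewrite /= in_itv.
exists l => A Al; have [//|FnA] := in_ultra_setVsetC (r @^-1` A) FU.
by have [? []] := cl (~` A) A FnA Al.
Qed.

Lemma ultra_cvg_cases (r : nat -> R) :
  [\/ r k @[k --> F] --> +oo, r k @[k --> F] --> -oo
    | exists l : R, r k @[k --> F] --> l].
Proof.
have [/cvgryPge ry|nry] := pselect (forall A, \forall k \near F, A <= r k).
  exact: Or31.
have [/cvgrNyPle rNy|nrNy] := pselect (forall A, \forall k \near F, r k <= A).
  exact: Or32.
apply: Or33; move: nry nrNy => /existsNP[b nb] /existsNP[a na].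
apply: (@ultra_bounded_cvg _ a b).
have [//|nb'] := in_ultra_setVsetC [set k | b <= r k] FU.
have [//|na'] := in_ultra_setVsetC [set k | r k <= a] FU.
near=> k; apply/andP; split; apply: ltW; rewrite ltNge; apply/negP.
  by near: k.
by near: k.
Unshelve. all: by end_near. Qed.

End Ultralimits.

(** * Linear forms and the separation of their growth rates *)

Section DotProduct.
Variables (R : realType) (N : nat).
Implicit Types a b c : 'rV[R]_N.

Lemma dotrBl a b c : dotr (a - b) c = dotr a c - dotr b c.
Proof.
by rewrite /dotr -sumrB; apply: eq_bigr => i _; rewrite !mxE mulrBl.
Qed.

Lemma dotrBr a b c : dotr a (b - c) = dotr a b - dotr a c.
Proof.
by rewrite /dotr -sumrB; apply: eq_bigr => i _; rewrite !mxE mulrBr.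
Qed.

Lemma dotrNl a b : dotr (- a) b = - dotr a b.
Proof. by rewrite /dotr -sumrN; apply: eq_bigr => i _; rewrite mxE mulNr. Qed.

Lemma dotrC a b : dotr a b = dotr b a.
Proof. by apply: eq_bigr => i _; rewrite mulrC. Qed.

Lemma dotr0 a : dotr a 0 = 0.
Proof. by rewrite /dotr big1// => j _; rewrite mxE mulr0. Qed.

Definition axis (e : R) (i : 'I_N) : 'rV[R]_N :=
  \row_j (if j == i then e else 0).

Lemma dotr_axis a (e : R) i : dotr a (axis e i) = a 0 i * e.
Proof.
rewrite /dotr (bigD1 i)//= mxE eqxx big1 ?addr0// => j ji.
by rewrite mxE (negbTE ji) mulr0.
Qed.

End DotProduct.

Section Scales.
Variables (R : realType) (F : set_system nat) (N : nat).
Context {FU : UltraFilter F}.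

(* [V] records the relative growth of the forms in [s] along [U], and [U0]
   the finite limits: subtracting from [U k] the part seen by the forms with a
   finite limit leaves a vector on which these vanish, while the others still
   tend to an infinity; any late term of that sequence serves as [V]. *)
Lemma scale_separation (U : nat -> 'rV[R]_N) (s : seq 'rV[R]_N) :
  exists U0 V : 'rV[R]_N, forall a, a \in s ->
    [\/ dotr V a = 0 /\ dotr (U k - U0) a @[k --> F] --> (0 : R),
        0 < dotr V a /\ dotr (U k - U0) a @[k --> F] --> +oo
      | dotr V a < 0 /\ dotr (U k - U0) a @[k --> F] --> -oo].
Proof.
pose fin a := `[< exists l : R, dotr (U k) a @[k --> F] --> l >].
pose B := [seq a <- s | fin a]; pose L := size B.
pose M : 'M[R]_(N, L) := \matrix_(i, j) (nth 0 B j) 0 i.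
have dotM (W : 'rV[R]_N) (j : 'I_L) : (W *m M) 0 j = dotr W (nth 0 B j).
  by rewrite mxE; apply: eq_bigr => i _; rewrite mxE.
have /choice[l lP] (j : 'I_L) : exists l : R, (U k *m M) 0 j @[k --> F] --> l.
  have : nth 0 B j \in B by rewrite mem_nth.
  rewrite mem_filter => /andP[/asboolP[l ul] _]; exists l.
  by under eq_fun do rewrite dotM.
(* The columns of [M] are the forms with a finite limit. [U k *m M *m P] agrees with [U k] on them
   and depends only on these values, so it converges. *)
pose lim := \row_j l j; pose P := pinvmx M.
have cvgP (W : nat -> 'rV[R]_L) (w : 'rV[R]_L) :
    (forall j, W k 0 j @[k --> F] --> w 0 j) ->
    forall m (C : 'M[R]_(L, m)) j, (W k *m C) 0 j @[k --> F] --> (w *m C) 0 j.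
  move=> Ww m C j; under eq_fun do rewrite mxE; rewrite mxE.
  by apply: cvg_sumr => i _; apply: cvgM => //; exact: cvg_cst.
have limP j : (U k *m M) 0 j @[k --> F] --> lim 0 j by rewrite mxE.
have UMP k : U k *m M *m P *m M = U k *m M by apply: mulmxKpV; exact: submxMl.
(* [UMP] passes to the limit: [lim *m P], the future [U0], takes the limit values on the columns of
   [M]. *)
have limE : lim *m P *m M = lim.
  apply/rowP => j; apply: cvg_unique (limP j) => //.
  rewrite /= -mulmxA.
  have -> : (fun k => (U k *m M) 0 j) = fun k => (U k *m M *m (P *m M)) 0 j.
    by apply/funext => k; rewrite mulmxA UMP.
  exact: cvgP.
pose V k := U k - U k *m M *m P.
have VB k a : a \in B -> dotr (V k) a = 0.
  move=> aB; have ai : (index a B < L)%N by rewrite index_mem.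
  by have := dotM (V k) (Ordinal ai); rewrite /= nth_index// => <-;
    rewrite /V mulmxBl UMP subrr mxE.
have dotcol (W a : 'rV[R]_N) : dotr W a = (W *m a^T) 0 0.
  by rewrite mxE; apply: eq_bigr => i _; rewrite !mxE.
(* The part subtracted in [V] converges on every form, so infinite limits survive the
   subtraction. *)
have Vb a : exists b : R, dotr (U k *m M *m P) a @[k --> F] --> b.
  exists ((lim *m (P *m a^T)) 0 0).
  under eq_fun do rewrite dotcol -mulmxA.
  exact: cvgP.
pose U0 := lim *m P.
have case_inf a : a \in s -> ~~ fin a ->
    (dotr (U k) a @[k --> F] --> +oo) \/ (dotr (U k) a @[k --> F] --> -oo).
  move=> _ /asboolP nfa; have [?|?|] := ultra_cvg_cases (fun k => dotr (U k) a).
  - by left.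
  - by right.
  - by move=> /nfa.
have sgn a : a \in s -> \forall k \near F,
   ((dotr (U k) a @[k --> F] --> +oo) -> 0 < dotr (V k) a) /\
   ((dotr (U k) a @[k --> F] --> -oo) -> dotr (V k) a < 0).
  move=> _; have [b bP] := Vb a.
  have Vle : \forall k \near F, dotr (U k *m M *m P) a <= b + 1.
    by apply: (cvgr_le _ bP); rewrite ltrDl.
  have Vge : \forall k \near F, b - 1 <= dotr (U k *m M *m P) a.
    by apply: (cvgr_ge _ bP); rewrite ltrBlDr ltrDl.
  have [/cvgryPgt uy|nuy] := pselect (dotr (U k) a @[k --> F] --> +oo);
  have [/cvgrNyPlt uNy|nuNy] := pselect (dotr (U k) a @[k --> F] --> -oo).
  - near=> k; split=> _; rewrite dotrBl.
      rewrite subr_gt0; apply: (@le_lt_trans _ _ (b + 1)); [by near: k|by near: k; exact: uy].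
    rewrite subr_lt0; apply: (@lt_le_trans _ _ (b - 1)); [by near: k; exact: uNy|by near: k].
  - near=> k; split=> // _; rewrite dotrBl.
    rewrite subr_gt0; apply: (@le_lt_trans _ _ (b + 1)); [by near: k|by near: k; exact: uy].
  - near=> k; split=> // _; rewrite dotrBl.
    rewrite subr_lt0; apply: (@lt_le_trans _ _ (b - 1)); [by near: k; exact: uNy|by near: k].
  - by near=> k.
have [k0 k0P] := filter_ex (near_all_mem sgn).
have sub_cvgy a : dotr (U k) a @[k --> F] --> +oo ->
    dotr (U k - U0) a @[k --> F] --> +oo.
  move=> /cvgryPge uy; apply/cvgryPge => A; near=> k.
  by rewrite dotrBl lerBrDr; near: k; exact: uy.
have sub_cvgNy a : dotr (U k) a @[k --> F] --> -oo ->
    dotr (U k - U0) a @[k --> F] --> -oo.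
  move=> /cvgrNyPle uy; apply/cvgrNyPle => A; near=> k.
  by rewrite dotrBl lerBlDr; near: k; exact: uy.
exists U0, (V k0) => a sa; have [fa|nfa] := boolP (fin a).
  have aB : a \in B by rewrite mem_filter fa.
  apply: Or31; split; first exact: VB.
  have ai : (index a B < L)%N by rewrite index_mem.
  have dE W : dotr W a = (W *m M) 0 (Ordinal ai) by rewrite dotM /= nth_index.
  have := limP (Ordinal ai); under eq_fun do rewrite -dE.
  move=> h; under eq_fun do rewrite dotrBl.
  rewrite -(subrr (dotr U0 a)); apply: cvgB; last exact: cvg_cst.
  by rewrite (dE U0) limE.
have [h1 h2] := k0P a sa.
have [uy|uNy] := case_inf a sa nfa; [apply: Or32|apply: Or33]; split.
- exact: h1.
- exact: sub_cvgy.
- exact: h2.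
- exact: sub_cvgNy.
Unshelve. all: by end_near. Qed.

End Scales.

(* [R[i]] carries no topology under its own name: it is found by unifying
   [R[i]] with the carrier of a generic [K : numFieldType]. *)
Definition tends_to (K : numFieldType) (T : Type) (F : set_system T)
    (z : T -> K) (l : K) : Prop := z x @[x --> F] --> l.

(** * Arithmetic of limits in a numeric field *)

Section TendsTo.
Variables (K : numFieldType) (T : Type) (F : set_system T).
Context {FF : Filter F}.
Implicit Types (z w : T -> K) (a b : K).

Lemma tends_cst a : tends_to F (fun=> a) a.
Proof. exact: cvg_cst. Qed.

Lemma tendsD z w a b :
  tends_to F z a -> tends_to F w b -> tends_to F (fun x => z x + w x) (a + b).
Proof. exact: cvgD. Qed.

Lemma tendsM z w a b :
  tends_to F z a -> tends_to F w b -> tends_to F (fun x => z x * w x) (a * b).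
Proof. exact: cvgM. Qed.

Lemma tendsX z a n : tends_to F z a -> tends_to F (fun x => z x ^+ n) (a ^+ n).
Proof. exact: cvg_exprn. Qed.

Lemma tends_sum (I : Type) (r : seq I) (P : pred I) (f : I -> T -> K) l :
  (forall i, P i -> tends_to F (f i) (l i)) ->
  tends_to F (fun x => \sum_(i <- r | P i) f i x) (\sum_(i <- r | P i) l i).
Proof. exact: cvg_sumr. Qed.

Lemma tends_prod (I : Type) (r : seq I) (P : pred I) (f : I -> T -> K) l :
  (forall i, P i -> tends_to F (f i) (l i)) ->
  tends_to F (fun x => \prod_(i <- r | P i) f i x) (\prod_(i <- r | P i) l i).
Proof. exact: cvg_prodr. Qed.

Lemma tends_near z w a :
  (\forall x \near F, z x = w x) -> tends_to F w a -> tends_to F z a.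
Proof.
move=> zw; apply: cvg_trans; apply: near_eq_cvg.
by apply: filterS zw => x ->.
Qed.

End TendsTo.

Lemma tends_unique (K : numFieldType) (T : Type) (F : set_system T)
    {FF : ProperFilter F} (z : T -> K) (a b : K) :
  tends_to F z a -> tends_to F z b -> a = b.
Proof. by move=> za zb; apply: cvg_unique za zb. Qed.

(** * Complex limits, exponential factors and polar forms *)

Section ComplexLimits.
Local Open Scope complex_scope.
Local Open Scope ring_scope.
Variables (R : realType).

Lemma normc_complexE (z : R[i]) : `|z| = (ComplexField.Normc.normc z)%:C.
Proof. by rewrite normc_def; case: z. Qed.

Lemma cvg_real_complex (T : Type) (F : set_system T) {FF : Filter F}
    (r : T -> R) (l : R) :
  r x @[x --> F] --> l -> tends_to F (fun x => (r x)%:C) l%:C.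
Proof.
move=> /cvgrPdist_lt rl; apply/cvgrPdist_lt => -[e e'].
rewrite ltcE /= => /andP[/eqP -> e0].
apply: filterS (rl e e0) => x lx.
by rewrite -rmorphB normc_def /= expr0n addr0 sqrtr_sqr ltcR.
Qed.

Lemma cvg_conjC (T : Type) (F : set_system T) {FF : Filter F}
    (z : T -> R[i]) (l : R[i]) :
  tends_to F z l -> tends_to F (fun x => (z x)^*) l^*.
Proof.
move=> /cvgrPdist_lt zl; apply/cvgrPdist_lt => e e0.
by apply: filterS (zl e e0) => x; rewrite -rmorphB norm_conjC.
Qed.

Lemma cvg_expR_1 (T : Type) (F : set_system T) {FF : Filter F} (r : T -> R) :
  r x @[x --> F] --> (0 : R) -> tends_to F (fun x => (expR (r x))%:C) 1.
Proof.
move=> r0; apply: cvg_real_complex; rewrite -expR0.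
exact: (cvg_comp _ _ r0 (@continuous_expR R 0)).
Qed.

Lemma cvg_expR_0 (T : Type) (F : set_system T) {FF : Filter F} (r : T -> R) :
  r x @[x --> F] --> -oo -> tends_to F (fun x => (expR (r x))%:C) 0.
Proof.
move=> /cvgNry ry; apply: cvg_real_complex.
have -> : (fun x => expR (r x)) = (fun y => expR (- y)) \o (fun x => - r x).
  by apply/funext => x /=; rewrite opprK.
exact: cvg_comp ry (@cvgr_expR R).
Qed.

Lemma cvg_expR_eq0 (T : Type) (F : set_system T) {FF : ProperFilter F}
    (r : T -> R) (z : T -> R[i]) (l c : R[i]) :
  r x @[x --> F] --> -oo -> tends_to F (fun x => (expR (r x))%:C * z x) l ->
  tends_to F z c -> l = 0.
Proof.
move=> ry rl zc; apply: tends_unique rl _.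
by rewrite -(mul0r c); exact: tendsM (cvg_expR_0 ry) zc.
Qed.

(** [w] is the phase of [z], of modulus 1, or 0 where [z] is 0 whatever [ln] returns there. It is
    bounded, hence has an ultralimit; a zero limit excludes modulus 1 and makes [z] vanish
    [F]-eventually. *)
Lemma polar_ultralimit (F : set_system nat) {FU : UltraFilter F}
    (z : nat -> R[i]) :
  exists (u : nat -> R) (w : nat -> R[i]) (t : R[i]),
    [/\ forall k, z k = (expR (u k))%:C * w k,
        tends_to F w t & t = 0 -> \forall k \near F, z k = 0].
Proof.
pose u k := ln (ComplexField.Normc.normc (z k)).
pose w k := (expR (- u k))%:C * z k.
have eu k : z k != 0 -> `|z k| = (expR (u k))%:C.
  by move=> zk; rewrite normc_complexE lnK// posrE -ltcR -normc_complexE normr_gt0.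
have zw k : z k = (expR (u k))%:C * w k.
  by rewrite mulrA -rmorphM -expRD subrr expR0 mul1r.
have w1 k : z k != 0 -> `|w k| = 1.
  move=> zk; have nz : `|z k| != 0 by rewrite normr_eq0.
  have := congr1 Num.norm (zw k); rewrite normrM -(eu k zk) normr_id.
  by rewrite -{1}[`|z k|]mulr1 => /(mulfI nz).
have w0 k : z k = 0 -> w k = 0 by move=> zk; rewrite /w zk mulr0.
have wle k : `|w k| <= 1.
  by have [/w0 ->|/w1 ->//] := eqVneq (z k) 0; rewrite normr0 ler01.
have [a wa] : exists a : R, complex.Re (w k) @[k --> F] --> a.
  apply: (@ultra_bounded_cvg R F FU _ (-1) 1); apply: filterE => k.
  by rewrite -ler_norml -lecR; apply: le_trans (wle k); exact: normc_ge_Re.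
have [b wb] : exists b : R, complex.Im (w k) @[k --> F] --> b.
  apply: (@ultra_bounded_cvg R F FU _ (-1) 1); apply: filterE => k.
  rewrite -ler_norml -lecR; apply: le_trans (wle k).
  case: (w k) => x y.
  by rewrite normc_def lecR /= -sqrtr_sqr ler_wsqrtr// lerDr sqr_ge0.
have wt : tends_to F w (a%:C + 'i%C * b%:C).
  rewrite (_ : w = fun k => (complex.Re (w k))%:C + 'i%C * (complex.Im (w k))%:C).
    apply: tendsD; first exact: cvg_real_complex.
    by apply: tendsM; [exact: tends_cst|exact: cvg_real_complex].
  by apply/funext => k; rewrite -complexE.
exists u, w, (a%:C + 'i%C * b%:C); split => // t0.
rewrite t0 in wt; move/cvgrPdist_lt: wt => /(_ 1 ltr01).
apply: filterS => k; rewrite sub0r normrN.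
by have [//|/w1 ->] := eqVneq (z k) 0; rewrite ltxx.
Qed.

End ComplexLimits.

(** * Monomials, evaluation and logarithmic derivatives *)

Section Monomials.
Variables (K : fieldType) (n : nat).
Implicit Types (m : 'X_{1..n}) (x : 'I_n -> K) (I : {set 'I_n}).

Definition supported I m := [forall i, (i \notin I) ==> (m i == 0%N)].

Lemma supportedP I m :
  reflect (forall i, i \notin I -> m i = 0%N) (supported I m).
Proof.
apply: (iffP fintype.forallP) => H i; first by move=> iI; have /implyP/(_ iI)/eqP := H i.
by apply/implyP => /H ->.
Qed.

Definition monval x m := \prod_(i < n) x i ^+ m i.

Lemma eq_monval I x y m :
  supported I m -> (forall i, i \in I -> x i = y i) -> monval x m = monval y m.
Proof.
move=> /supportedP mI xy; apply: eq_bigr => i _.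
by have [/xy ->//|/mI ->] := boolP (i \in I).
Qed.

Lemma monval_eq0 I x m :
  (forall i, i \notin I -> x i = 0) -> ~~ supported I m -> monval x m = 0.
Proof.
move=> xI /fintype.forallPn[j]; rewrite negb_imply => /andP[jI mj].
by rewrite /monval (bigD1 j)//= xI// expr0n (negbTE mj) mul0r.
Qed.

Definition mpoly_sum (r : seq 'X_{1..n}) (P : pred 'X_{1..n})
    (a : 'X_{1..n} -> K) : {mpoly K[n]} := \sum_(m <- r | P m) a m *: 'X_[m].

Lemma mpoly_sum_msupp (f : {mpoly K[n]}) :
  f = mpoly_sum (msupp f) xpredT (fun m => f@_m).
Proof. by rewrite /mpoly_sum -mpolyE. Qed.

Variables (r : seq 'X_{1..n}) (P : pred 'X_{1..n}) (a : 'X_{1..n} -> K).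
Let h := mpoly_sum r P a.

Lemma meval_mpoly_sum x : h.@[x] = \sum_(m <- r | P m) a m * monval x m.
Proof.
by rewrite raddf_sum; apply: eq_bigr => m _; rewrite /= mevalZ mevalX.
Qed.

Lemma mderiv_mpoly_sum i :
  h^`M(i) = \sum_(m <- r | P m) (a m * (m i)%:R) *: 'X_[m - U_(i)].
Proof.
by rewrite raddf_sum; apply: eq_bigr => m _; rewrite /= mderivZ mderivX scalerA.
Qed.

(** The factor [x i] restores the exponent lowered by the derivative, so zero coordinates are
    allowed. If [m i] is 0, truncated subtraction leaves [m] unchanged, but the coefficient is then
    0. *)
Lemma logderiv_mpoly_sum x i :
  x i * (h^`M(i)).@[x] = \sum_(m <- r | P m) a m * (m i)%:R * monval x m.
Proof.
rewrite mderiv_mpoly_sum raddf_sum mulr_sumr; apply: eq_bigr => m _ /=.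
rewrite mevalZ mevalX mulrCA; have [->|mi] := eqVneq (m i) 0%N.
  by rewrite mulr0 !mul0r.
congr (_ * _); rewrite /monval (bigD1 i)//= [RHS](bigD1 i)//= mulrA -exprS.
congr (_ * _); first by rewrite mnmBE mnm1E eqxx subn1 prednK// lt0n.
apply: eq_bigr => j ji.
by rewrite mnmBE mnm1E eq_sym (negbTE ji) subn0.
Qed.

Lemma mderiv_supported I x y i :
  (forall m, m \in r -> P m -> supported I m) -> (forall j, j \in I -> x j = y j) ->
  (h^`M(i)).@[x] = (h^`M(i)).@[y].
Proof.
move=> rI xy; rewrite mderiv_mpoly_sum !raddf_sum big_seq_cond [RHS]big_seq_cond.
apply: eq_bigr => m /andP[mr Pm] /=; rewrite !mevalZ !mevalX; congr (_ * _).
apply: (@eq_monval I) => //; apply/supportedP => j jI.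
by rewrite mnmBE (supportedP I m (rI m mr Pm)).
Qed.

End Monomials.

(** * Newton polyhedra, faces and convenience *)

Section NewtonFaces.
Variables (R : realType) (n : nat).
Implicit Types (f : {mpoly R[i][n]}) (I : {set 'I_n}) (q V : 'rV[R]_n).

Lemma dotr_exponent q (m : 'X_{1..n}) :
  dotr q (exponent R m) = \sum_(i < n) q 0 i * (m i)%:R.
Proof. by apply: eq_bigr => i _; rewrite mxE. Qed.

Lemma msupp_mrestrict I f m :
  (m \in msupp (mrestrict I f)) = (m \in msupp f) && supported I m.
Proof.
rewrite mcoeff_msupp /mrestrict raddf_sum /=.
under eq_bigr do rewrite mcoeffZ mcoeffX.
rewrite big_mkcond /=.
have [mf|mf] := boolP (m \in msupp f); last first.
  rewrite big_seq big1 ?eqxx// => m' m'f.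
  rewrite (negbTE (_ : m' != m)) ?mulr0 ?if_same//.
  by apply/eqP => m'm; rewrite m'm (negbTE mf) in m'f.
rewrite (bigD1_seq m) ?msupp_uniq//= big1 ?addr0 => [|m' /negbTE ->]; last first.
  by rewrite mulr0 if_same.
by rewrite eqxx mulr1; case: ifP; rewrite ?eqxx// -mcoeff_msupp mf.
Qed.

Lemma newton_polyhedron_half_space f q d a :
  (forall m, m \in msupp f -> d <= dotr q (exponent R m)) ->
  newton_polyhedron f a -> d <= dotr q a.
Proof.
move=> fq /(_ [set b | d <= dotr q b]); apply; split.
  exact: dotr_half_space_convex.
by move=> _ [m mf <-]; exact: fq.
Qed.

Lemma exponent_newton_polyhedron f m :
  m \in msupp f -> newton_polyhedron f (exponent R m).
Proof. by move=> mf; apply: sub_gen_smallest; exists m. Qed.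

Lemma exponent_mrestrict I f m :
  newton_polyhedron (mrestrict I f) (exponent R m) -> supported I m.
Proof.
move=> fm; apply/supportedP => i iI.
have : 0 <= dotr (axis (- 1) i) (exponent R m).
  apply: newton_polyhedron_half_space fm => m'.
  rewrite msupp_mrestrict => /andP[_ /supportedP/(_ i iI) m'i].
  by rewrite dotrC dotr_axis mxE m'i mul0r.
by rewrite dotrC dotr_axis mxE mulrN1 oppr_ge0 lern0 => /eqP.
Qed.

(* The direction is [V = - q], so minima become maxima. *)
Lemma leading_partE I f V : mrestrict I f != 0 ->
  exists D : R,
    [/\ forall m, m \in msupp f -> supported I m -> dotr V (exponent R m) <= D,
        exists m, [/\ m \in msupp f, supported I m & dotr V (exponent R m) = D],
        newton_dist (- V) (newton_polyhedron (mrestrict I f)) = - D &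
        leading_part I (- V) f =
          mpoly_sum (msupp f)
            (fun m => supported I m && (dotr V (exponent R m) == D))
            (fun m => f@_m)].
Proof.
move=> f0; set P := newton_polyhedron _.
have [[a [Pa aD]] Dle] := newton_dist_min (- V) f0; rewrite -/P in Pa aD Dle.
have Pexp m : m \in msupp f -> supported I m -> P (exponent R m).
  move=> mf mI; apply: exponent_newton_polyhedron.
  by rewrite msupp_mrestrict; apply/andP.
exists (- newton_dist (- V) P); split=> [m mf mI|||].
- by rewrite lerNr -dotrNl; exact: Dle (Pexp _ mf mI).
- move: f0; rewrite -msupp_eq0; case E: (msupp _) => [//|m0 s] _.
  pose G (m : seq_sub (msupp (mrestrict I f))) := dotr V (exponent R (val m)).
  have m0P : m0 \in msupp (mrestrict I f) by rewrite E mem_head.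
  have [m _ mP] := @arg_maxP _ _ _ (SeqSub m0P) predT G isT.
  have := valP m; rewrite msupp_mrestrict => /andP[mf mI].
  exists (val m); split=> //; apply/eqP; rewrite eq_le; apply/andP; split.
    by rewrite lerNr -dotrNl; exact: Dle (Pexp _ mf mI).
  rewrite lerNl -aD; apply: newton_polyhedron_half_space Pa => m' m'f.
  by rewrite dotrNl lerN2; exact: (mP (SeqSub m'f) isT).
- by rewrite opprK.
rewrite /leading_part /face_part /mpoly_sum big_seq_cond [RHS]big_seq_cond.
apply: eq_bigl => m; have [mf|//] := boolP (m \in msupp f).
rewrite /= -eqr_oppLR -dotrNl; apply/idP/andP.
  rewrite inE => -[Pm ->]; split=> //; exact: exponent_mrestrict Pm.
move=> [mI /eqP Vm]; by rewrite inE; split; [exact: Pexp|].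
Qed.

(** Without a pure power of the [i]-th variable, the form with coefficient -1 at [i] and a large [M]
    elsewhere is nonnegative on the support, hence on the polyhedron. On the axis it equals
    [- a 0 i], which forces [a = 0]. *)
Lemma convenient_axis f i : convenient f ->
  exists m, [/\ m \in msupp f, (0 < m i)%N & forall j, j != i -> m j = 0%N].
Proof.
move=> /(_ i)[a [fa a0 aj]]; apply: contrapT => nex.
pose M : R := (\max_(m <- msupp f) m i)%:R.
have ai_ge0 : 0 <= a 0 i.
  rewrite -[a 0 i]mulr1 -dotr_axis dotrC.
  apply: newton_polyhedron_half_space fa => m _.
  by rewrite dotrC dotr_axis mulr1 mxE.
have : 0 <= dotr (\row_j (if j == i then - 1 else M)) a.
  apply: newton_polyhedron_half_space fa => m mf.
  rewrite dotr_exponent (bigD1 i)//= mxE eqxx mulN1r.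
  under eq_bigr => j /negbTE ji do rewrite mxE ji -natrM.
  rewrite addrC subr_ge0 -natr_sum ler_nat.
  have [mj|] := pselect (forall j, j != i -> m j = 0%N).
    have [->//|mi] := posnP (m i).
    by case: nex; exists m.
  move=> /existsNP[j /not_implyP[ji /eqP mj]].
  rewrite (bigD1 j)//=; apply: leq_trans (leq_addr _ _).
  apply: leq_trans (leq_pmulr _ _); rewrite ?lt0n//.
  exact: leq_bigmax_seq.
rewrite /dotr (bigD1 i)//= mxE eqxx mulN1r big1 => [|j ji]; last first.
  by rewrite aj// mulr0.
rewrite addr0 oppr_ge0 => ai_le0; move/eqP: a0; apply; apply/rowP => j.
rewrite mxE; have [->|/aj//] := eqVneq j i.
by apply/eqP; rewrite eq_le ai_le0.
Qed.

End NewtonFaces.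

(** * Coefficients of a relation in a free family *)

Lemma free_map_sum_eq0 (K : fieldType) (vT : vectType K) (J : eqType) (s : seq J)
    (v : J -> vT) (c : J -> K) :
  uniq s -> free [seq v j | j <- s] -> \sum_(j <- s) c j *: v j = 0 ->
  forall j, j \in s -> c j = 0.
Proof.
elim: s => [//|i s IH] /= /andP[iNs us]; rewrite free_cons big_cons.
move=> /andP[vNs fs] s0.
have sP : \sum_(j <- s) c j *: v j \in <<[seq v j | j <- s]>>%VS.
  by rewrite big_seq; apply: memv_suml => j js; rewrite memvZ// memv_span// map_f.
have ci : c i = 0.
  apply: contraNeq vNs => ci; rewrite -[v i](scalerK ci) memvZ//.
  by move/eqP: s0; rewrite addr_eq0 => /eqP ->; rewrite memvN.
move=> j; rewrite in_cons => /predU1P[->//|]; apply: IH => //.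
by rewrite ci scale0r add0r in s0.
Qed.

(** * Asymptotic scales and limits of weighted sums *)

Section Asymptotics.
Local Open Scope complex_scope.
Local Open Scope ring_scope.
Variables (R : realType) (F : set_system nat).
Context {FU : UltraFilter F}.

(** Separation is applied to differences of forms in [s]. The shift [U0] moves from the log-moduli
    into the convergent factors [y], so that forms equal at [V] differ by a quantity tending to 0,
    not merely to a finite limit. *)
Lemma asymptotic_scales (N : nat) (z : nat -> 'rV[R[i]]_N) (s : seq 'rV[R]_N) :
  exists (T : nat -> 'rV[R]_N) (y : nat -> 'rV[R[i]]_N) (z0 : 'rV[R[i]]_N)
      (V : 'rV[R]_N),
    [/\ forall k i, z k 0 i = (expR (T k 0 i))%:C * y k 0 i,
        forall i, tends_to F (fun k => y k 0 i) (z0 0 i),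
        forall i, z0 0 i = 0 -> \forall k \near F, z k 0 i = 0 &
        forall a b, a \in s -> b \in s ->
          (dotr V a = dotr V b ->
             dotr (T k) a - dotr (T k) b @[k --> F] --> (0 : R)) /\
          (dotr V a < dotr V b ->
             dotr (T k) a - dotr (T k) b @[k --> F] --> -oo)].
Proof.
have [u Hu] := choice (fun i : 'I_N => polar_ultralimit (fun k => z k 0 i)).
have [w Hw] := choice Hu; have [t uwt] := choice Hw.
pose U k := \row_i u i k.
have [U0 [V UV]] := scale_separation U [seq a - b | a <- s, b <- s].
exists (fun k => U k - U0), (fun k => \row_i ((expR (U0 0 i))%:C * w i k)),
  (\row_i ((expR (U0 0 i))%:C * t i)), V; split=> [k j|j|j|a b sa sb].
- have [-> _ _] := uwt j; rewrite !mxE mulrA -rmorphM -expRD.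
  by rewrite subrK.
- have [_ wt _] := uwt j; rewrite mxE.
  apply: (@tends_near _ _ _ _ _ (fun k => (expR (U0 0 j))%:C * w j k)).
    by apply: filterE => k; rewrite mxE.
  by apply: tendsM; [exact: tends_cst|exact: wt].
- have [_ _] := uwt j; rewrite mxE => H /eqP.
  rewrite mulf_eq0 fmorph_eq0 gt_eqF ?expR_gt0//= => /eqP; exact: H.
have ab : a - b \in [seq a - b | a <- s, b <- s] by apply/allpairsP; exists (a, b).
under eq_fun do rewrite -dotrBr.
have := UV _ ab; rewrite dotrBr.
split=> [Vab|Vab]; case: H => -[].
- by [].
- by rewrite Vab subrr ltxx.
- by rewrite Vab subrr ltxx.
- by move=> /eqP; rewrite subr_eq0 lt_eqF.
- by rewrite subr_gt0 => /lt_trans/(_ Vab); rewrite ltxx.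
- by [].
Qed.

Lemma monval_scaled (n : nat) (x y : 'I_n -> R[i]) (t : 'rV[R]_n)
    (m : 'X_{1..n}) :
  (forall i, x i = (expR (t 0 i))%:C * y i) ->
  monval x m = (expR (dotr t (exponent R m)))%:C * monval y m.
Proof.
move=> xy; rewrite dotr_exponent expR_sum rmorph_prod -big_split.
by apply: eq_bigr => j _ /=; rewrite xy exprMn expRM_natr rmorphXn.
Qed.

(** [expR (e k)] stands for the inverse of a dominant scale. Terms of weight [l] keep a factor
    tending to 1 and lighter ones tend to 0, which leaves the face of weight [l]. *)
Lemma weighted_sum_tends (n : nat) (x y : nat -> 'I_n -> R[i]) (x0 : 'I_n -> R[i])
    (t : nat -> 'rV[R]_n) (e : nat -> R) (V : 'rV[R]_n) (l : R)
    (r : seq 'X_{1..n}) (P : pred 'X_{1..n}) (a : 'X_{1..n} -> R[i]) :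
  (forall k i, x k i = (expR (t k 0 i))%:C * y k i) ->
  (forall i, tends_to F (fun k => y k i) (x0 i)) ->
  (forall m, m \in r -> P m ->
     (dotr V (exponent R m) = l /\
        dotr (t k) (exponent R m) + e k @[k --> F] --> (0 : R)) \/
     (dotr V (exponent R m) < l /\
        dotr (t k) (exponent R m) + e k @[k --> F] --> -oo)) ->
  tends_to F
    (fun k => (expR (e k))%:C * \sum_(m <- r | P m) a m * monval (x k) m)
    (\sum_(m <- r | P m && (dotr V (exponent R m) == l)) a m * monval x0 m).
Proof.
move=> xy yx0 H.
apply: (@tends_near _ _ _ _ _ (fun k => \sum_(m <- r | (m \in r) && P m)
    (expR (dotr (t k) (exponent R m) + e k))%:C * (a m * monval (y k) m))).
  apply: filterE => k; rewrite mulr_sumr big_seq_cond; apply: eq_bigr => m _.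
  by rewrite (monval_scaled m (xy k)) addrC expRD rmorphM mulrACA mulrA.
rewrite (_ : \sum_(m <- r | _ && (_ == l)) _ = \sum_(m <- r | (m \in r) && P m)
    (if dotr V (exponent R m) == l then 1 else 0) * (a m * monval x0 m)).
  apply: tends_sum => m /andP[mr Pm]; apply: tendsM.
    have [[-> te]|[lV te]] := H m mr Pm; first by rewrite eqxx; exact: cvg_expR_1.
    by rewrite lt_eqF//; exact: cvg_expR_0.
  apply: tendsM; first exact: tends_cst.
  by apply: tends_prod => j _; exact: tendsX.
rewrite -big_seq_cond big_mkcondr; apply: eq_bigr => m _.
by case: ifP; rewrite ?mul1r ?mul0r.
Qed.

End Asymptotics.

Lemma seq_argmax (d : Order.disp_t) (T : eqType) (O : orderType d) (s : seq T)
    (h : T -> O) (x : T) : x \in s ->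
  exists2 r, r \in s & forall y, y \in s -> (h y <= h r)%O.
Proof.
case: s => // z s _; elim: s z => [|w s IH] z.
  by exists z; rewrite ?mem_head// => y; rewrite inE => /eqP ->.
have [r rs rmax] := IH w; have [zr|rz] := leP (h z) (h r).
  exists r; first by rewrite in_cons rs orbT.
  by move=> y; rewrite in_cons => /predU1P[->//|]; exact: rmax.
exists z; first exact: mem_head.
move=> y; rewrite in_cons => /predU1P[->//|/rmax yr].
exact: le_trans yr (ltW rz).
Qed.

(** * Logarithmic forms of the terms to be compared *)

Section LogForms.
Variables (R : realType) (n p : nat).

(* [log |x^a kappa^b nu^c|], as a linear form in the logarithms of the moduli. *)
Definition log_form (a : 'rV[R]_n) (b : 'rV[R]_p) (c : R) : 'rV[R]_(n + (p + 1)) :=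
  row_mx a (row_mx b c%:M).

Lemma dotr_row_mx (n1 n2 : nat) (V : 'rV[R]_(n1 + n2)) a b :
  dotr V (row_mx a b) = dotr (lsubmx V) a + dotr (rsubmx V) b.
Proof.
rewrite /dotr big_split_ord /=; congr (_ + _); apply: eq_bigr => j _.
  by rewrite row_mxEl mxE.
by rewrite row_mxEr mxE.
Qed.

Lemma dotr_log_form (V : 'rV[R]_(n + (p + 1))) a b c :
  dotr V (log_form a b c) = dotr (lsubmx V) a + dotr (lsubmx (rsubmx V)) b +
    rsubmx (rsubmx V) 0 0 * c.
Proof.
rewrite !dotr_row_mx addrA; congr (_ + _).
by rewrite /dotr big_ord1 !mxE eqxx mulr1n.
Qed.

End LogForms.

(** * Limit of the tangency equation *)

Section TangencyLimit.
Local Open Scope complex_scope.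
Local Open Scope ring_scope.
Variables (R : realType) (n p : nat).

Lemma mrestrict_eq0_supported (I : {set 'I_n}) (h : {mpoly R[i][n]}) m :
  mrestrict I h = 0 -> m \in msupp h -> ~~ supported I m.
Proof.
move=> h0 mh; have := msupp_mrestrict I h m; rewrite h0 msupp0 in_nil.
by move=> /esym/negbT; rewrite negb_and => /orP[/negP//|].
Qed.

Lemma meval_supported (I : {set 'I_n}) (h : {mpoly R[i][n]}) (x : 'I_n -> R[i]) :
  (forall i, i \notin I -> x i = 0) ->
  h.@[x] = \sum_(m <- msupp h | supported I m) h@_m * monval x m.
Proof.
move=> xI; rewrite {1}(mpoly_sum_msupp h) meval_mpoly_sum [RHS]big_mkcond.
apply: eq_bigr => m _; case: ifPn => // mI.
by rewrite (monval_eq0 xI mI) mulr0.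
Qed.

Lemma logderiv_supported (I : {set 'I_n}) (h : {mpoly R[i][n]})
    (x : 'I_n -> R[i]) i : (forall i, i \notin I -> x i = 0) ->
  x i * (h^`M(i)).@[x] =
  \sum_(m <- msupp h | supported I m) h@_m * (m i)%:R * monval x m.
Proof.
move=> xI; rewrite {1}(mpoly_sum_msupp h) logderiv_mpoly_sum [RHS]big_mkcond.
apply: eq_bigr => m _; case: ifPn => // mI.
by rewrite (monval_eq0 xI mI) mulr0.
Qed.

Lemma tends_bounded_norm (F : set_system nat) {FF : Filter F}
    (x : nat -> 'rV[R[i]]_n) (a : 'I_n -> R[i]) :
  (forall i, tends_to F (fun k => x k 0 i) (a i)) ->
  exists B, \forall k \near F, hermitian_norm (x k) <= B.
Proof.
move=> xa; pose N := ComplexField.Normc.normc.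
exists (Num.sqrt (\sum_(i < n) (N R (a i) + 1) ^+ 2)).
have : \forall k \near F, forall i, `|a i - x k 0 i| < 1.
  apply: filter_forall => i; have /cvgrPdist_lt/(_ 1 ltr01) := xa i.
  by apply: filterS.
apply: filterS => k xk; rewrite ler_wsqrtr//; apply: ler_sum => i _.
have N0 (w : R[i]) : 0 <= N R w by rewrite -lecR -normc_complexE normr_ge0.
rewrite ler_sqr ?nnegrE ?addr_ge0//.
rewrite -lecR rmorphD -!normc_complexE rmorph1.
rewrite -[x k 0 i](subKr (a i)); apply: le_trans (ler_normB _ _) _.
by rewrite lerD2l ltW// xk.
Qed.

(** Conjugating the [i]-th coordinate moves the conjugates from [nabla] to the multipliers;
    multiplying by [x 0 i] then gives logarithmic derivatives and a squared modulus. *)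
Lemma tangency_equation (f : {mpoly R[i][n]}) (g : 'I_p -> {mpoly R[i][n]})
    (x : 'rV[R[i]]_n) (lam : 'I_p -> R[i]) (mu : R[i]) (i : 'I_n) :
  nabla f x + \sum_(j < p) lam j *: nabla (g j) x = mu *: x ->
  x 0 i * (f^`M(i)).@[x 0] + \sum_(j < p) (lam j)^* * (x 0 i * ((g j)^`M(i)).@[x 0])
    = mu^* * (x 0 i * (x 0 i)^*).
Proof.
move=> /(congr1 (fun w : 'rV__ => x 0 i * (w 0 i)^*)).
rewrite !mxE rmorphD rmorphM /= conjCK mulrDr summxE.
rewrite [RHS]mulrCA => <-; congr (_ + _).
rewrite rmorph_sum mulr_sumr; apply: eq_bigr => j _.
by rewrite !mxE rmorphM /= conjCK mulrCA.
Qed.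

(** [D] precedes the hypothesis so that [choice] applies to all [j]; it is 0 by default when the
    restriction vanishes. *)
Lemma exists_leading_max (h : {mpoly R[i][n]}) (I : {set 'I_n}) (V : 'rV[R]_n) :
  exists D : R, mrestrict I h != 0 ->
    [/\ forall m, m \in msupp h -> supported I m -> dotr V (exponent R m) <= D,
        exists m, [/\ m \in msupp h, supported I m & dotr V (exponent R m) = D] &
        leading_part I (- V) h =
          mpoly_sum (msupp h)
            (fun m => supported I m && (dotr V (exponent R m) == D))
            (fun m => h@_m)].
Proof.
have [_|/(leading_partE V)[D [Dle Dm _ lead]]] := eqVneq (mrestrict I h) 0.
  by exists 0.
by exists D.
Qed.

(* Here [q = - V]. [J] and [b] tell which of the [g_j], and whether [f], reach
   the dominant weight in the tangency equation multiplied by [x_i]. *)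
Lemma tangency_limit (f : {mpoly R[i][n]}) (g : 'I_p -> {mpoly R[i][n]}) c :
  T_infty f g c ->
  exists (I : {set 'I_n}) (V : 'rV[R]_n) (x0 : 'rV[R[i]]_n),
    [/\ coord_torus I x0, exists2 i, i \in I & 0 < V 0 i,
        mrestrict I f = 0 -> c = 0 &
        mrestrict I f != 0 ->
        let lead := leading_part I (- V) in
        let d := newton_dist (- V) (newton_polyhedron (mrestrict I f)) in
        [/\ [/\ 0 < d -> c = 0, d = 0 -> c = (lead f).@[x0 0] &
                d < 0 -> (lead f).@[x0 0] = 0],
            forall j, mrestrict I (g j) != 0 -> (lead (g j)).@[x0 0] = 0 &
            exists (J : {set 'I_p}) (b : bool) (kappa : 'I_p -> R[i])
                (nu : R[i]) (v : R),
              [/\ forall j, j \in J -> mrestrict I (g j) != 0 /\ kappa j != 0,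
                  b || (J != finset.set0), 0 < v &
                  forall i, b%:R * (x0 0 i * ((lead f)^`M(i)).@[x0 0]) +
                    \sum_(j in J) kappa j * (x0 0 i * ((lead (g j))^`M(i)).@[x0 0]) =
                  if (i \in I) && (V 0 i == v)
                  then nu * (x0 0 i * (x0 0 i)^*) else 0]]].
Proof.
move=> [x [lam [mu [xS xoo fc eqn]]]].
have [F [FU FN]] := ultraFilterLemma eventually_filter.
pose z k : 'rV[R[i]]_(n + (p + 1)) :=
  row_mx (x k) (row_mx (\row_j (lam k j)^*) ((mu k)^*)%:M).
(* The log-moduli to compare: the constant 1, the monomials of [f], those of [g j] times the [j]-th
   multiplier, the coordinates, and the last multiplier times squared coordinates. *)
pose s : seq 'rV[R]_(n + (p + 1)) :=
  0 :: [seq log_form (exponent R m) 0 0 | m <- msupp f] ++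
  [seq log_form (exponent R m) (axis 1 j) 0 | j <- enum 'I_p, m <- msupp (g j)] ++
  [seq log_form (axis 1 i) 0 0 | i <- enum 'I_n] ++
  [seq log_form (axis 2 i) 0 1 | i <- enum 'I_n].
have s_0 : 0 \in s by rewrite mem_head.
have s_f m : m \in msupp f -> log_form (exponent R m) 0 0 \in s.
  move=> mf; rewrite in_cons mem_cat; apply/orP; right; apply/orP; left.
  by apply/mapP; exists m.
have s_g j m : m \in msupp (g j) -> log_form (exponent R m) (axis 1 j) 0 \in s.
  move=> mg; rewrite in_cons !mem_cat; apply/orP; right; apply/orP; right.
  apply/orP; left; apply/allpairsPdep; exists j, m; split=> //.
  by rewrite mem_enum.
have s_1 i : log_form (axis 1 i) 0 0 \in s.
  rewrite in_cons !mem_cat (map_f (fun i => log_form (axis 1 i) 0 0)) ?mem_enum//.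
  by rewrite !orbT.
have s_2 i : log_form (axis 2 i) 0 1 \in s.
  rewrite in_cons !mem_cat (map_f (fun i => log_form (axis 2 i) 0 1)) ?mem_enum//.
  by rewrite !orbT.
have [T [y [z0 [V [zT yz z00 sV]]]]] := asymptotic_scales z s.
have cmp0 a b r : a \in s -> b \in s -> dotr V a = dotr V b ->
    (forall k, r k = dotr (T k) a - dotr (T k) b) -> r k @[k --> F] --> (0 : R).
  move=> sa sb ab rE; have [+ _] := sV a b sa sb => /(_ ab).
  by rewrite (_ : r = fun k => dotr (T k) a - dotr (T k) b)//; apply/funext.
have cmpN a b r : a \in s -> b \in s -> dotr V a < dotr V b ->
    (forall k, r k = dotr (T k) a - dotr (T k) b) -> r k @[k --> F] --> -oo.
  move=> sa sb ab rE; have [_] := sV a b sa sb => /(_ ab).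
  by rewrite (_ : r = fun k => dotr (T k) a - dotr (T k) b)//; apply/funext.
pose tx k := lsubmx (T k); pose tk k := lsubmx (rsubmx (T k)).
pose tn k := rsubmx (rsubmx (T k)) 0 0.
pose yx k := lsubmx (y k); pose yk k := lsubmx (rsubmx (y k)).
pose yn k := rsubmx (rsubmx (y k)) 0 0.
pose x0 := lsubmx z0; pose k0 := lsubmx (rsubmx z0).
pose n0 := rsubmx (rsubmx z0) 0 0.
pose Vx := lsubmx V; pose Vk := lsubmx (rsubmx V).
pose Vn := rsubmx (rsubmx V) 0 0.
have xE k i : x k 0 i = (expR (tx k 0 i))%:C * yx k 0 i.
  by rewrite !mxE -zT row_mxEl.
have kE k j : (lam k j)^* = (expR (tk k 0 j))%:C * yk k 0 j.
  by rewrite !mxE -zT row_mxEr row_mxEl mxE.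
have nE k : (mu k)^* = (expR (tn k))%:C * yn k.
  by rewrite /tn /yn !mxE -zT !row_mxEr mxE eqxx.
have yx0 i : tends_to F (fun k => yx k 0 i) (x0 0 i).
  by rewrite mxE; apply: tends_near (yz _); apply: filterE => k; rewrite mxE.
have yk0 i : tends_to F (fun k => yk k 0 i) (k0 0 i).
  by rewrite !mxE; apply: tends_near (yz _); apply: filterE => k; rewrite !mxE.
have yn0 : tends_to F yn n0.
  rewrite /n0 !mxE; apply: tends_near (yz _); apply: filterE => k.
  by rewrite /yn !mxE.
have x_0 i : x0 0 i = 0 -> \forall k \near F, x k 0 i = 0.
  by rewrite mxE => /z00; apply: filterS => k; rewrite row_mxEl.
have k_0 j : k0 0 j = 0 -> \forall k \near F, (lam k j)^* = 0.
  by rewrite !mxE => /z00; apply: filterS => k; rewrite row_mxEr row_mxEl mxE.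
have n_0 : n0 = 0 -> \forall k \near F, (mu k)^* = 0.
  by rewrite /n0 !mxE => /z00; apply: filterS => k; rewrite !row_mxEr mxE eqxx.
(* A coordinate whose normalised limit is 0 vanishes [F]-eventually, so the sequence enters the
   coordinate subspace of [I]. *)
pose I := [set i | x0 0 i != 0]%SET.
have x_out : \forall k \near F, forall i, i \notin I -> x k 0 i = 0.
  apply: filter_forall => i; have [xi|xi] := eqVneq (x0 0 i) 0.
    by apply: filterS (x_0 i xi).
  by apply: filterE => k; rewrite finset.inE xi.
have x0_out i : i \notin I -> x0 0 i = 0 by rewrite finset.inE negbK => /eqP.
have [i0 i0I Vi0] : exists2 i, i \in I & 0 < Vx 0 i.
  (* Otherwise every coordinate converges, its scale tending to 1 where [Vx] is 0 and to 0 where it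
     is negative; the norm could not diverge. *)
  apply: contrapT => noV.
  have [|B xB] := @tends_bounded_norm F _ x (fun i =>
      if (i \in I) && (Vx 0 i == 0) then x0 0 i else 0).
    move=> i; have [iI|iI] := boolP (i \in I); last first.
      apply: (@tends_near _ _ _ _ _ (fun=> 0)); last exact: tends_cst.
      exact: x_0 (x0_out i iI).
    have Vi_le0 : Vx 0 i <= 0 by rewrite leNgt; apply/negP => Vi; apply: noV; exists i.
    apply: (@tends_near _ _ _ _ _ (fun k => (expR (tx k 0 i))%:C * yx k 0 i)).
      by apply: filterE.
    rewrite /= (_ : (if _ then _ else _) = (if Vx 0 i == 0 then 1 else 0) * x0 0 i).
      apply: tendsM; last exact: yx0.
      have [Vi|Vi] := eqVneq (Vx 0 i) 0.
        apply: cvg_expR_1; apply: (cmp0 _ _ _ (s_1 i) s_0).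
          by rewrite dotr_log_form !dotr_axis !dotr0 -/Vx Vi !mul0r mulr0 !addr0.
        move=> k; rewrite dotr_log_form !dotr_axis !dotr0 -/(tx k).
        by rewrite mulr1 mulr0 !addr0 subr0.
      apply: cvg_expR_0; apply: (cmpN _ _ _ (s_1 i) s_0).
        rewrite dotr_log_form !dotr_axis !dotr0 -/Vx mulr1 mulr0 !addr0.
        by rewrite lt_neqAle Vi.
      move=> k; rewrite dotr_log_form !dotr_axis !dotr0 -/(tx k).
      by rewrite mulr1 mulr0 !addr0 subr0.
    by case: eqVneq; rewrite ?mul1r ?mul0r.
  have /cvgryPge/(_ (B + 1))/FN xB1 := xoo.
  have [k [/le_trans H /H]] := filter_ex (filterI xB1 xB).
  by rewrite gerDl ler10.
have fcF : tends_to F (fun k => f.@[x k 0]) c.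
  by move=> A cA; apply: FN; exact: (fc A cA).
exists I, Vx, x0; split; first by move=> i; rewrite finset.inE.
- by exists i0.
- move=> f0; apply: (tends_unique fcF).
  apply: (@tends_near _ _ _ _ _ (fun=> 0)); last exact: tends_cst.
  apply: filterS x_out => k xk; rewrite (meval_supported _ xk) big_seq_cond big1//.
  by move=> m /andP[mf]; rewrite (negbTE (mrestrict_eq0_supported f0 mf)).
move=> f0 lead d.
have [D [Dle [m0 [m0f m0I m0D]] dE leadf]] := leading_partE Vx f0.
rewrite -/lead in leadf; rewrite -/d in dE.
have [Dg HDg] := choice (fun j : 'I_p => exists_leading_max (g j) I Vx).
(* After division by the scale of [rho], only monomials of weight [l] survive, and none if [h] stays
   below [l]. The coefficients [a] serve values as well as logarithmic derivatives; [b] selects a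
   multiplier or none. *)
have tends_h rho l b (h : {mpoly R[i][n]}) a : rho \in s ->
    (forall m, m \in msupp h -> log_form (exponent R m) b 0 \in s) ->
    (forall m, m \in msupp h -> supported I m -> dotr Vx (exponent R m) <= l) ->
    dotr V rho = l + dotr Vk b ->
    tends_to F (fun k => (expR (dotr (tk k) b - dotr (T k) rho))%:C *
        \sum_(m <- msupp h | supported I m) a m * monval (x k 0) m)
      (\sum_(m <- msupp h | supported I m && (dotr Vx (exponent R m) == l))
         a m * monval (x0 0) m).
  move=> srho sh hl Vrho; apply: weighted_sum_tends; first exact: xE.
    exact: yx0.
  move=> m mh mI.
  have := hl m mh mI; rewrite le_eqVlt => /predU1P[ml|ml]; [left|right]; split=> //.
    apply: (cmp0 _ _ _ (sh m mh) srho).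
      by rewrite Vrho dotr_log_form -/Vx -/Vk ml mulr0 addr0.
    by move=> k; rewrite dotr_log_form mulr0 addr0 addrA.
  apply: (cmpN _ _ _ (sh m mh) srho).
    by rewrite Vrho dotr_log_form -/Vx -/Vk mulr0 addr0 ltrD2r.
  by move=> k; rewrite dotr_log_form mulr0 addr0 addrA.
have lead_eval j : mrestrict I (g j) != 0 -> (lead (g j)).@[x0 0] = 0.
  move=> gj0; have [Dgle [m [mg mI mD]] leadg] := HDg j gj0.
  (* The multiplier occurs in both [rho] and the forms of [g j], and cancels. *)
  have tg := tends_h (log_form (exponent R m) (axis 1 j) 0) (Dg j) (axis 1 j) (g j)
    (fun m => (g j)@_m) (s_g j m mg) (s_g j) Dgle.
  rewrite /lead leadg meval_mpoly_sum; apply: (tends_unique (tg _)).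
    by rewrite dotr_log_form -/Vx -/Vk mD mulr0 addr0.
  apply: (@tends_near _ _ _ _ _ (fun=> 0)); last exact: tends_cst.
  apply: filterS x_out => k xk; rewrite -(meval_supported _ xk).
  by rewrite xS ?mulr0// codom_f.
have f_eval k : (forall i, i \notin I -> x k 0 i = 0) -> f.@[x k 0] =
    \sum_(m <- msupp f | supported I m) f@_m * monval (x k 0) m.
  by move=> xk; rewrite (meval_supported _ xk).
have c_le0 : D <= 0 -> c =
    \sum_(m <- msupp f | supported I m && (dotr Vx (exponent R m) == 0))
      f@_m * monval (x0 0) m.
  move=> D0; apply: (tends_unique fcF).
  (* The scale is the constant 1, which no monomial outgrows when [D <= 0]. *)
  have tf := tends_h 0 0 0 f (fun m => f@_m) s_0 s_f
    (fun m mf mI => le_trans (Dle m mf mI) D0).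
  apply: tends_near (tf _); last by rewrite !dotr0 addr0.
  apply: filterS x_out => k /f_eval ->.
  by rewrite !dotr0 subrr expR0 mul1r.
have sumD l : D < l -> forall a : 'X_{1..n} -> R[i],
    \sum_(m <- msupp f | supported I m && (dotr Vx (exponent R m) == l)) a m = 0.
  move=> Dl a; rewrite big_seq_cond big1// => m /and3P[mf mI /eqP ml].
  by have := Dle m mf mI; rewrite ml leNgt Dl.
split=> //.
  split=> d0.
  - have D0 : D < 0 by rewrite -oppr_gt0 -dE.
    by rewrite (c_le0 (ltW D0)) sumD.
  - have D0 : D = 0 by apply/eqP; rewrite -oppr_eq0 -dE d0.
    by rewrite leadf meval_mpoly_sum D0 c_le0 ?D0.
  (* The scale of the top monomials diverges while the values of [f] converge, so the quotient tends
     to 0. *)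
  have D0 : 0 < D by rewrite -oppr_lt0 -dE.
  have tf := tends_h (log_form (exponent R m0) 0 0) D 0 f (fun m => f@_m)
    (s_f _ m0f) s_f Dle.
  rewrite leadf meval_mpoly_sum.
  apply: (@cvg_expR_eq0 R nat F _
     (fun k => dotr (tk k) 0 - dotr (T k) (log_form (exponent R m0) 0 0))
     (fun k => f.@[x k 0]) _ c _ _ fcF).
    apply: (cmpN _ _ _ s_0 (s_f _ m0f)).
      by rewrite dotr_log_form !dotr0 -/Vx m0D mulr0 !addr0.
    by move=> k; rewrite !dotr0.
  apply: tends_near (tf _); last by rewrite dotr_log_form -/Vx m0D mulr0 !addr0.
  by apply: filterS x_out => k /f_eval ->.
(* Outside [J0] the term of [g j] vanishes [F]-eventually, through its multiplier or its
   restriction. In [weight], [None] stands for [f]; [l] is the dominant weight on the left. *)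
pose J0 := [set j | (k0 0 j != 0) && (mrestrict I (g j) != 0)]%SET.
pose weight (o : option 'I_p) := if o is Some j then Dg j + Vk 0 j else D.
have [o oJ omax] := @seq_argmax _ _ _ (None :: [seq Some j | j <- enum J0])
  weight None (mem_head _ _).
pose l := weight o.
have [rho srho Vrho] : exists2 rho, rho \in s & dotr V rho = l.
  rewrite /l; case: o oJ {omax l} => [j|_] /=; last first.
    exists (log_form (exponent R m0) 0 0); rewrite ?s_f//.
    by rewrite dotr_log_form -/Vx m0D dotr0 mulr0 !addr0.
  rewrite in_cons /= mem_map; last by move=> ? ? [].
  rewrite mem_enum finset.inE => /andP[_ gj0].
  have [_ [m [mg mI mD]] _] := HDg j gj0.
  exists (log_form (exponent R m) (axis 1 j) 0); first exact: s_g.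
  by rewrite dotr_log_form -/Vx -/Vk mD dotr_axis mulr1 mulr0 addr0.
have Dl : D <= l by apply: (omax None); rewrite mem_head.
have Dgl j : j \in J0 -> Dg j + Vk 0 j <= l.
  move=> jJ; apply: (omax (Some j)); rewrite in_cons /= mem_map; last by move=> ? ? [].
  by rewrite mem_enum.
pose J := [set j in J0 | Dg j + Vk 0 j == l]%SET.
have J_J0 j : j \in J -> j \in J0 by rewrite finset.inE => /andP[].
(* The value of [Vx 0 i] at which the right-hand term has weight [l]. If [n0] is 0 that term
   vanishes [F]-eventually and any positive value would do. *)
pose v := if n0 == 0 then 1 else (l - Vn) / 2%:R.
pose Lf i := \sum_(m <- msupp f | supported I m && (dotr Vx (exponent R m) == l))
   (f@_m * (m i)%:R) * monval (x0 0) m.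
have LfE i : Lf i = (D == l)%:R * (x0 0 i * ((lead f)^`M(i)).@[x0 0]).
  have [Dl'|Dl'] := eqVneq D l.
    by rewrite mul1r leadf logderiv_mpoly_sum Dl'.
  by rewrite mul0r /Lf sumD// lt_neqAle Dl'.
have f_tends i : tends_to F (fun k => (expR (- dotr (T k) rho))%:C *
    \sum_(m <- msupp f | supported I m) (f@_m * (m i)%:R) * monval (x k 0) m) (Lf i).
  have tf := tends_h rho l 0 f (fun m => f@_m * (m i)%:R) srho s_f
    (fun m mf mI => le_trans (Dle m mf mI) Dl).
  apply: tends_near (tf _); last by rewrite dotr0 addr0.
  by apply: filterE => k; rewrite dotr0 sub0r.
have g_tends i j : tends_to F (fun k => (expR (- dotr (T k) rho))%:C *
    ((lam k j)^* * (x k 0 i * ((g j)^`M(i)).@[x k 0])))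
    (if j \in J then k0 0 j * (x0 0 i * ((lead (g j))^`M(i)).@[x0 0]) else 0).
  have [jJ0|] := boolP (j \in J0); last first.
    rewrite finset.inE negb_and !negbK => jJ0.
    rewrite ifN; last first.
      by apply/negP => /J_J0; rewrite finset.inE; case/orP: jJ0 => ->; rewrite ?andbF.
    apply: (@tends_near _ _ _ _ _ (fun=> 0)); last exact: tends_cst.
    case/orP: jJ0 => /eqP j0.
      by apply: filterS (k_0 _ j0) => k ->; rewrite mul0r mulr0.
    apply: filterS x_out => k xk; rewrite (logderiv_supported _ _ xk) big_seq_cond.
    rewrite big1 ?mulr0// => m /andP[mg].
    by rewrite (negbTE (mrestrict_eq0_supported j0 mg)).
  have gj0 : mrestrict I (g j) != 0 by move: jJ0; rewrite finset.inE => /andP[].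
  have [Dgle _ leadg] := HDg j gj0.
  have Dgl' : Dg j <= l - Vk 0 j by rewrite lerBrDr Dgl.
  have tg := tends_h rho (l - Vk 0 j) (axis 1 j) (g j) (fun m => (g j)@_m * (m i)%:R)
    srho (s_g j) (fun m mf mI => le_trans (Dgle m mf mI) Dgl').
  have {}tg := tg _; rewrite Vrho dotr_axis mulr1 subrK in tg.
  apply: (@tends_near _ _ _ _ _ (fun k => yk k 0 j *
    ((expR (dotr (tk k) (axis 1 j) - dotr (T k) rho))%:C *
     \sum_(m <- msupp (g j) | supported I m)
       (g j)@_m * (m i)%:R * monval (x k 0) m))).
    apply: filterS x_out => k xk; rewrite (logderiv_supported _ _ xk) kE.
    by rewrite dotr_axis mulr1 addrC expRD rmorphM /=; ring.
  rewrite (_ : (if _ then _ else _) = k0 0 j *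
    \sum_(m <- msupp (g j) | supported I m && (dotr Vx (exponent R m) == l - Vk 0 j))
       (g j)@_m * (m i)%:R * monval (x0 0) m).
    by apply: tendsM; [exact: yk0|exact: tg].
  rewrite finset.inE jJ0 /=; have [Dj|Dj] := eqVneq (Dg j + Vk 0 j) l.
    by rewrite /lead leadg logderiv_mpoly_sum -Dj addrK.
  rewrite big_seq_cond big1 ?mulr0// => m /and3P[mg mI /eqP ml].
  case/eqP: Dj; apply/le_anti; rewrite Dgl// -lerBlDr -ml; exact: Dgle.
pose L i := Lf i + \sum_(j < p)
  (if j \in J then k0 0 j * (x0 0 i * ((lead (g j))^`M(i)).@[x0 0]) else 0).
have L_tends i : tends_to F (fun k => (expR (- dotr (T k) rho))%:C *
    ((mu k)^* * (x k 0 i * (x k 0 i)^*))) (L i).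
  apply: (@tends_near _ _ _ _ _ (fun k => (expR (- dotr (T k) rho))%:C *
    (\sum_(m <- msupp f | supported I m) (f@_m * (m i)%:R) * monval (x k 0) m) +
    \sum_(j < p) (expR (- dotr (T k) rho))%:C *
      ((lam k j)^* * (x k 0 i * ((g j)^`M(i)).@[x k 0])))); last first.
    apply: tendsD; first exact: f_tends.
    by apply: tends_sum => j _; exact: g_tends.
  apply: filterS x_out => k xk.
  have te := tangency_equation i (eqn k).
  rewrite /= -te (logderiv_supported f i xk) mulrDr; congr (_ + _).
  by rewrite mulr_sumr.
have rhsE k i : (expR (- dotr (T k) rho))%:C * ((mu k)^* * (x k 0 i * (x k 0 i)^*)) =
    (expR (tx k 0 i * 2 + tn k - dotr (T k) rho))%:C *
    (yn k * (yx k 0 i * (yx k 0 i)^*)).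
  rewrite nE xE rmorphM /= conj_Creal ?complex_real//.
  by rewrite !expRD mulr2n mulrDr mulr1 expRD !rmorphM /=; ring.
have y_tends i : tends_to F (fun k => yn k * (yx k 0 i * (yx k 0 i)^*))
    (n0 * (x0 0 i * (x0 0 i)^*)).
  apply: tendsM; first exact: yn0.
  by apply: tendsM; [exact: yx0|exact: (cvg_conjC (yx0 i))].
have dotr_i W i : dotr W (log_form (axis 2 i) 0 1) =
    lsubmx W 0 i * 2 + rsubmx (rsubmx W) 0 0.
  by rewrite dotr_log_form dotr_axis dotr0 addr0 mulr1.
have x0_n0 i : i \in I -> n0 != 0 -> n0 * (x0 0 i * (x0 0 i)^*) != 0.
  by rewrite finset.inE => xi n0i; rewrite !mulf_neq0// conjC_eq0.
(* If the right-hand term were heavier, division by its own scale would give 0 on the left and a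
   nonzero limit on the right. *)
have V_le i : n0 != 0 -> i \in I -> Vx 0 i * 2 + Vn <= l.
  move=> nn0 iI; rewrite leNgt; apply/negP => lV.
  have := x0_n0 i iI nn0; apply/negP; rewrite negbK; apply/eqP.
  apply: (@cvg_expR_eq0 R nat F _
    (fun k => dotr (T k) rho - (tx k 0 i * 2 + tn k)) _ _ (L i) _ _ (L_tends i)).
    apply: (cmpN _ _ _ srho (s_2 i)); first by rewrite dotr_i Vrho.
    by move=> k; rewrite dotr_i.
  apply: tends_near (y_tends i); apply: filterE => k.
  by rewrite rhsE mulrA -rmorphM -expRD addrA subrK subrr expR0 mul1r.
have LE i : L i = if (i \in I) && (Vx 0 i == v) then n0 * (x0 0 i * (x0 0 i)^*) else 0.
  apply: (tends_unique (L_tends i)).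
  have [iI|iI] := boolP (i \in I); last first.
    apply: (@tends_near _ _ _ _ _ (fun=> 0)); last exact: tends_cst.
    by apply: filterS x_out => k xk; rewrite xk// mul0r !mulr0.
  have [n00|nn0] := eqVneq n0 0.
    rewrite n00 mul0r if_same.
    apply: (@tends_near _ _ _ _ _ (fun=> 0)); last exact: tends_cst.
    by apply: filterS (n_0 n00) => k ->; rewrite mul0r mulr0.
  apply: (@tends_near _ _ _ _ _ (fun k =>
    (expR (tx k 0 i * 2 + tn k - dotr (T k) rho))%:C *
    (yn k * (yx k 0 i * (yx k 0 i)^*)))).
    by apply: filterE => k; rewrite rhsE.
  rewrite (_ : (if _ then _ else _) =
    (if Vx 0 i == v then 1 else 0) * (n0 * (x0 0 i * (x0 0 i)^*))); last first.
    by rewrite /=; case: ifP; rewrite ?mul1r ?mul0r.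
  apply: tendsM; last exact: y_tends.
  have -> : (Vx 0 i == v) = (Vx 0 i * 2 + Vn == l).
    by rewrite /v (negbTE nn0); apply/eqP/eqP => h; lra.
  have [Vl|Vl] := eqVneq (Vx 0 i * 2 + Vn) l.
    apply: cvg_expR_1; apply: (cmp0 _ _ _ (s_2 i) srho); first by rewrite dotr_i Vrho.
    by move=> k; rewrite dotr_i.
  apply: cvg_expR_0; apply: (cmpN _ _ _ (s_2 i) srho).
    by rewrite dotr_i Vrho lt_neqAle Vl V_le.
  by move=> k; rewrite dotr_i.
exists J, (D == l), (k0 0), n0, v; split.
- by move=> j /J_J0; rewrite finset.inE => /andP[].
- have [//|/= Dnl] := eqVneq D l; apply/set0Pn.
  move: oJ omax Dnl; rewrite /J /l; case: (o) => [j|]; last by rewrite eqxx.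
  rewrite in_cons /= mem_map; last by move=> ? ? [].
  by rewrite mem_enum => jJ _ _; exists j; rewrite finset.inE jJ eqxx.
- rewrite /v; have [_|nn0] := eqVneq n0 0; first exact: ltr01.
  (* [(l - Vn) / 2] is at least [Vx 0 i0], which is positive. *)
  by have := V_le i0 nn0 i0I; lra.
- by move=> i; rewrite -LE /L LfE; congr (_ + _); rewrite -big_mkcond.
Qed.

End TangencyLimit.

(** * Leading parts: variables involved and Euler's identity *)

Section LeadingParts.
Local Open Scope complex_scope.
Local Open Scope ring_scope.
Variables (R : realType) (n : nat).

(** Only the variables of [I] occur in the leading part, so coordinates outside [I] can be made
    nonzero at no cost. *)
Lemma eq_on_leading (I : {set 'I_n}) (q : 'rV[R]_n) (h : {mpoly R[i][n]})
    (x y : 'I_n -> R[i]) :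
  (forall i, i \in I -> x i = y i) ->
  (leading_part I q h).@[x] = (leading_part I q h).@[y] /\
  forall i, ((leading_part I q h)^`M(i)).@[x] = ((leading_part I q h)^`M(i)).@[y].
Proof.
move=> xy; pose P m :=
  exponent R m \in newton_face q (newton_polyhedron (mrestrict I h)).
have PI m : P m -> supported I m by rewrite /P inE => -[/exponent_mrestrict].
have -> : leading_part I q h = mpoly_sum (msupp h) P (fun m => h@_m) by [].
split=> [|i]; last by apply: mderiv_supported xy => m _ /PI.
rewrite !meval_mpoly_sum; apply: eq_bigr => m /PI mI; congr (_ * _).
exact: eq_monval mI xy.
Qed.

Lemma leading_logderiv_out (I : {set 'I_n}) (q : 'rV[R]_n) (h : {mpoly R[i][n]})
    (x : 'I_n -> R[i]) i :
  i \notin I -> x i * ((leading_part I q h)^`M(i)).@[x] = 0.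
Proof.
move=> iI; pose P m :=
  exponent R m \in newton_face q (newton_polyhedron (mrestrict I h)).
have -> : leading_part I q h = mpoly_sum (msupp h) P (fun m => h@_m) by [].
rewrite logderiv_mpoly_sum big1// => m; rewrite /P inE => -[/exponent_mrestrict].
by move=> /supportedP/(_ i iI) ->; rewrite mulr0 mul0r.
Qed.

(** All exponents of the leading part lie on one face, so it is quasi-homogeneous for the weights
    [V], of degree minus the distance. *)
Lemma leading_euler (I : {set 'I_n}) (V : 'rV[R]_n) (h : {mpoly R[i][n]})
    (x : 'I_n -> R[i]) : mrestrict I h != 0 ->
  \sum_(i < n) (V 0 i)%:C * (x i * ((leading_part I (- V) h)^`M(i)).@[x]) =
  (- newton_dist (- V) (newton_polyhedron (mrestrict I h)))%:C *
    (leading_part I (- V) h).@[x].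
Proof.
move=> /(leading_partE V)[D [_ _ -> ->]]; rewrite opprK meval_mpoly_sum.
under eq_bigr do rewrite logderiv_mpoly_sum mulr_sumr.
rewrite exchange_big mulr_sumr; apply: eq_bigr => m /= /andP[_ /eqP <-].
rewrite dotr_exponent rmorph_sum mulr_suml; apply: eq_bigr => j _ /=.
by rewrite rmorphM rmorph_nat; ring.
Qed.

End LeadingParts.

(** * Conclusion from non-degeneracy *)

Theorem theorem3p2 (R : realType) (n p : nat) (f : {mpoly R[i][n]})
    (g : 'I_p -> {mpoly R[i][n]}) :
  smooth_complete_intersection setT (codom g) ->
  newton_nondegenerate_at_infinity f g ->
  T_infty f g `<=` Sigma_infty f g `|` K_0 f g `|` [set 0] /\
  (convenient f -> T_infty f g = set0).
Proof.
move=> _ nd.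
suff key c : T_infty f g c -> (Sigma_infty f g c \/ c = 0) /\ ~ convenient f.
  split=> [c /key[[Sc|->] _]|fconv]; [by left; left|by right|].
  by rewrite -subset0 => c /key[].
move=> /tangency_limit[I [V [x0 [x0I [i0 i0I Vi0] f_eq0 H]]]].
have Ine : I != finset.set0 by apply/set0Pn; exists i0.
(* A convenient [f] contains a pure power of the variable [i0], hence does not vanish on the
   coordinate subspace. *)
have [f0|f0] := eqVneq (mrestrict I f) 0.
  split; first by right; exact: f_eq0.
  move=> /(convenient_axis i0)[m [mf _ mj]].
  have := mrestrict_eq0_supported f0 mf; apply/negP; rewrite negbK.
  by apply/supportedP => j jI; apply: mj; apply: contraNneq jI => ->.
have {H} [[c_pos c_0 lead_0] g_0 [J [b [kappa [nu [v [JP bJ v0 HL]]]]]]] := H f0.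
set lead := leading_part I (- V) in c_0 lead_0 g_0 HL.
set d := newton_dist _ _ in c_pos c_0 lead_0.
have minV : (min_coord I (- V) < 0)%E.
  by apply/bigmin_ltP; right; exists i0 => //; rewrite mxE lte_fin oppr_lt0.
have d_conv : convenient f -> d < 0.
  move=> /(convenient_axis i0)[m [mf mi mj]].
  have mI : supported I m.
    by apply/supportedP => j jI; apply: mj; apply: contraNneq jI => ->.
  have [D [Dle _ dE _]] := leading_partE V f0.
  rewrite /d dE oppr_lt0; apply: lt_le_trans (Dle m mf mI).
  rewrite dotr_exponent (bigD1 i0)//= big1 ?addr0 ?mulr_gt0 ?ltr0n// => j ji.
  by rewrite mj// mulr0.
suff : 0 < d \/ (d = 0 /\ Sigma_infty f g c).
  case=> [d_gt0|[d0 Sc]]; split; [by right; exact: c_pos| |by left|].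
    by move=> /d_conv; rewrite ltNge ltW.
  by move=> /d_conv; rewrite d0 ltxx.
have [/andP[nu0 /fintype.existsP[i1 /andP[i1I Vi1]]]|noI] :=
    boolP ((nu != 0) && [exists i, (i \in I) && (V 0 i == v)]).
  (* The equations are summed with weights [V]. Euler's identity removes the [g j], whose leading
     parts vanish at [x0], and leaves [- d] times the leading part of [f]. The right side is
     nonzero, so neither factor vanishes, which excludes [d <= 0]. *)
  left; have : \sum_(i < n) (V 0 i)%:C%C * (b%:R * (x0 0 i * ((lead f)^`M(i)).@[x0 0]) +
      \sum_(j in J) kappa j * (x0 0 i * ((lead (g j))^`M(i)).@[x0 0])) =
      v%:C%C * nu * \sum_(i | (i \in I) && (V 0 i == v)) x0 0 i * (x0 0 i)^*.
    rewrite mulr_sumr [RHS]big_mkcond; apply: eq_bigr => i _; rewrite HL.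
    by case: ifP => [/andP[_ /eqP ->]|_]; rewrite ?mulr0// mulrA.
  under eq_bigr do rewrite mulrDr mulr_sumr.
  rewrite big_split exchange_big /= [X in _ + X]big1 ?addr0 => [|j jJ]; last first.
    under eq_bigr do rewrite mulrCA; rewrite -mulr_sumr leading_euler; last first.
      by have [] := JP j jJ.
    by rewrite g_0 ?mulr0//; have [] := JP j jJ.
  under eq_bigr do rewrite mulrCA; rewrite -mulr_sumr leading_euler// -/lead -/d.
  move=> E; have {E} : b%:R * ((- d)%:C%C * (lead f).@[x0 0]) != 0.
    rewrite E !mulf_neq0//; first by rewrite fmorph_eq0 gt_eqF.
    apply/negP => /eqP/psumr_eq0P x00; have : x0 0 i1 * (x0 0 i1)^* = 0.
      by apply: x00 => [i _|]; rewrite ?mul_conjC_ge0// i1I Vi1.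
    by move/eqP; rewrite mul_conjC_eq0; apply/negP; rewrite x0I.
  rewrite !mulf_eq0 !negb_or fmorph_eq0 oppr_eq0 => /and3P[_ d0 /eqP lead0].
  by rewrite lt_neqAle eq_sym d0 leNgt; apply/negP => /lead_0.
have {}HL i : b%:R * (x0 0 i * ((lead f)^`M(i)).@[x0 0]) +
    \sum_(j in J) kappa j * (x0 0 i * ((lead (g j))^`M(i)).@[x0 0]) = 0.
  rewrite HL; case: ifP => // iV; move: noI; rewrite negb_and negbK.
  case/orP=> [/eqP ->|]; first by rewrite mul0r.
  by rewrite negb_exists => /fintype.forallP/(_ i); rewrite iV.
(* Non-degeneracy concerns the full torus, so the zero coordinates of [x0] become 1. *)
pose x1 : 'rV[R[i]]_n := \row_i if i \in I then x0 0 i else 1.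
have x01 i : i \in I -> x1 0 i = x0 0 i by rewrite mxE => ->.
have x1_torus : torus x1.
  by move=> i; rewrite mxE; case: ifP => [|_]; [rewrite x0I|exact: oner_neq0].
have lead_x1 h : (lead h).@[x1 0] = (lead h).@[x0 0].
  by have [] := eq_on_leading (- V) h x01.
have nabla_x1 h : nabla (lead h) x1 = nabla (lead h) x0.
  by apply/rowP => i; rewrite !mxE; have [_ ->] := eq_on_leading (- V) h x01.
have logd_x1 h i :
    x1 0 i * ((lead h)^`M(i)).@[x1 0] = x0 0 i * ((lead h)^`M(i)).@[x0 0].
  have [iI|iI] := boolP (i \in I); last by rewrite !leading_logderiv_out.
  by rewrite x01//; have [_ ->] := eq_on_leading (- V) h x01.
have dep : b%:R *: nabla (lead f) x1 +
    \sum_(j in J) (kappa j)^* *: nabla (lead (g j)) x1 = 0.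
  apply/rowP => i; rewrite !mxE summxE.
  transitivity (b%:R * ((lead f)^`M(i)).@[x1 0] +
      \sum_(j in J) kappa j * ((lead (g j))^`M(i)).@[x1 0])^*.
    rewrite rmorphD rmorphM rmorph_nat; congr (_ + _).
    rewrite rmorph_sum; apply: eq_bigr => j _.
    by rewrite !mxE rmorphM.
  (* The nonzero coordinate of [x1] can be cancelled from the logarithmic derivatives. *)
  apply/eqP; rewrite conjC_eq0; apply/eqP/(mulfI (x1_torus i)).
  rewrite mulr0 -[RHS](HL i) mulrDr; congr (_ + _); first by rewrite mulrCA logd_x1.
  by rewrite big_distrr; apply: eq_bigr => j _; rewrite /= mulrCA logd_x1.
have [sg sfg] := nd I J (- V) Ine f0 (fun j jJ => (JP j jJ).1) minV.
have gJ_x1 h : h \in [seq lead (g j) | j <- enum J] -> h.@[x1 0] = 0.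
  move=> /mapP[j]; rewrite mem_enum => jJ ->.
  by rewrite lead_x1 g_0//; have [] := JP j jJ.
have {sg} := sg x1 (conj x1_torus gJ_x1); rewrite -map_comp => free_g.
(* Without [f], a relation with [J] nonempty and nonzero coefficients contradicts the independence
   of the leading gradients of the [g j]. *)
case: b bJ dep {HL} => [_|/set0Pn[j jJ]] dep; last first.
  have [_ /negP[]] := JP j jJ; rewrite -conjC_eq0; apply/eqP.
  apply: (free_map_sum_eq0 (c := fun j => (kappa j)^*) (enum_uniq _) free_g); last first.
    by rewrite mem_enum.
  by move: dep; rewrite scale0r add0r big_enum.
rewrite scale1r in dep.
(* With [f] present, [d < 0] makes [x1] a zero of its leading part too, against the second clause of
   non-degeneracy. For [d = 0] the relation, carried back to [x0], is the one defining
   [Sigma_infty]. *)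
have [d_lt0|d_gt0|d0] := ltgtP d 0; [exfalso|by left|right].
  have f_x1 h : h \in lead f :: [seq lead (g j) | j <- enum J] -> h.@[x1 0] = 0.
    by rewrite in_cons => /predU1P[->|/gJ_x1//]; rewrite lead_x1 lead_0.
  have := sfg d_lt0 x1 (conj x1_torus f_x1).
  rewrite /= free_cons => /andP[/negP vN _]; apply: vN.
  move/eqP: dep; rewrite addr_eq0 => /eqP ->.
  rewrite memvN; apply: memv_suml => j jJ; apply/memvZ/memv_span.
  by rewrite -map_comp; apply/mapP; exists j; rewrite ?mem_enum.
split; first exact: d0.
exists I, J, (- V), x0, (fun j => (kappa j)^*); split.
- by split; [exact: Ine|exact: f0|move=> j /JP[]].
- by split; [exact: minV|exact: d0].
- exact: x0I.
- by split; [exact: c_0|move=> j /JP[/g_0]].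
apply: etrans dep; congr (_ + _); first by rewrite nabla_x1.
by apply: eq_bigr => j _; rewrite nabla_x1.
Qed.
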